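(* Let $Y$ be a rearrangement-invariant (r.i.) space over $\mathbb{R}^n$ such that $$\psi\in Y(0,\infty),\qquad\text{where } \psi(t)=\min\{1,\tfrac1t\},\quad t\in(0,\infty). \tag{A}$$ Define the functional $\varrho$ by $$\varrho(f)=\|f^{**}\|_{Y(0,\infty)},\qquad f\in\mathcal{M}_+(\mathbb{R}^n).$$ Then $\varrho$ is an r.i. norm and $M\colon X\to Y$, where $M$ is the Hardy–Littlewood maximal operator and $X=X(\varrho)$. Moreover, $X$ is the optimal (largest) r.i. space over $\mathbb{R}^n$ for which $M\colon X\to Y$ holds, i.e. $Z\hookrightarrow X$ for every r.i. space $Z$ over $\mathbb{R}^n$ such that $M\colon Z\to Y$. Conversely, if (A) is not true, then there does not exist an r.i. space $X$ over $\mathbb{R}^n$ for which $M\colon X\to Y$ holds.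
   Context: Let $R$ be $\mathbb{R}^n$ or $(0,\infty)$ with Lebesgue measure $\mu$ (also written $|\cdot|$). $\mathcal{M}(R)$ is the set of measurable functions on $R$ with values in $[-\infty,\infty]$ and $\mathcal{M}_+(R)$ the set of nonnegative ones. For $f\in\mathcal{M}(R)$, $f^*(t)=\inf\{\lambda\in(0,\infty):\mu(\{|f|>\lambda\})\le t\}$ and $f^{**}(t)=\frac1t\int_0^tf^*(s)\,ds$. An r.i. norm on $R$ is a functional $\varrho\colon\mathcal{M}_+(R)\to[0,\infty]$ such that for all $f,g,f_j\in\mathcal{M}_+(R)$ and $\lambda\ge0$: (P1) $\varrho(f)=0$ iff $f=0$ a.e., $\varrho(\lambda f)=\lambda\varrho(f)$, $\varrho(f+g)\le\varrho(f)+\varrho(g)$; (P2) $f\le g$ a.e. implies $\varrho(f)\le\varrho(g)$; (P3) $f_j\nearrow f$ a.e. implies $\varrho(f_j)\nearrow\varrho(f)$; (P4) $\varrho(\chi_E)<\infty$ whenever $\mu(E)<\infty$; (P5) if $\mu(E)<\infty$, then $\int_Ef\,d\mu\le C_E\varrho(f)$ with a constant $C_E$ independent of $f$; (P6) $\varrho(f)=\varrho(g)$ whenever $f^*=g^*$. The r.i. space determined by $\varrho$ is $X(\varrho)=\{f\in\mathcal{M}(R):\varrho(|f|)<\infty\}$, with $\|f\|_{X(\varrho)}=\varrho(|f|)$. For an r.i. space $Y$ over $\mathbb{R}^n$, $Y(0,\infty)$ denotes its representation space, the unique r.i. space over $(0,\infty)$ with $\|f\|_Y=\|f^*\|_{Y(0,\infty)}$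 for all $f$. $T\colon X\to Y$ means there is $C>0$ with $\|Tf\|_Y\le C\|f\|_X$ for all $f\in X$; $X\hookrightarrow Y$ means this for the identity operator. The Hardy–Littlewood maximal operator is $Mf(x)=\sup_{Q\ni x}\frac1{|Q|}\int_Q|f(y)|\,dy$, $x\in\mathbb{R}^n$, for locally integrable $f$ on $\mathbb{R}^n$, the supremum being over all cubes $Q\subset\mathbb{R}^n$ containing $x$ with edges parallel to the coordinate axes. *)

(* Defs.v *)
From HB Require Import structures.
From mathcomp Require Import all_boot all_order all_algebra.
From mathcomp Require Import all_classical all_reals all_analysis.
From mathcomp Require Import measurable_realfun.

Set Implicit Arguments.
Unset Strict Implicit.
Unset Printing Implicit Defensive.

Import Order.TTheory GRing.Theory Num.Theory.
Import numFieldNormedType.Exports.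

Local Open Scope classical_set_scope.
Local Open Scope ring_scope.
Local Open Scope ereal_scope.

Section lebesgue_Rn.
Context (R : realType) (n : nat).
Implicit Types (a b : 'rV[R]_n) (A : set 'rV[R]_n).

Definition box a b : set 'rV[R]_n :=
  [set x | forall i, (a ord0 i < x ord0 i <= b ord0 i)%R].

Definition box_volume a b : \bar R :=
  (\prod_(i < n) Num.max 0 (b ord0 i - a ord0 i))%:E.

(* A cover is a countable family of boxes; indexing it by an arbitrary set of
   naturals allows finite and empty families, hence measure 0 for the empty set
   in every dimension. *)
Definition box_cover A : set (set nat * (nat -> 'rV[R]_n * 'rV[R]_n)) :=
  [set F | A `<=` \bigcup_(k in F.1) box (F.2 k).1 (F.2 k).2].

Definition lebesgue_outer A : \bar R :=
  ereal_inf [set \esum_(k in F.1) box_volume (F.2 k).1 (F.2 k).2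
            | F in box_cover A].

Lemma box_volume_ge0 a b : 0 <= box_volume a b.
Proof. by rewrite lee_fin prodr_ge0// => i _; rewrite le_max lexx. Qed.

Lemma lebesgue_outer_ge0 A : 0 <= lebesgue_outer A.
Proof.
apply: le_ereal_inf_tmp => _ [F _ <-].
by apply: esum_ge0 => k _; exact: box_volume_ge0.
Qed.

Lemma lebesgue_outer0 : lebesgue_outer set0 = 0.
Proof.
apply/eqP; rewrite eq_le lebesgue_outer_ge0 andbT.
apply: ereal_inf_lbound; exists (set0, fun=> (0%R, 0%R)) => //=.
by rewrite esum_set0.
Qed.

Lemma le_lebesgue_outer :
  {homo lebesgue_outer : A B / A `<=` B >-> A <= B}.
Proof.
move=> A B AB; apply/ereal_inf_le_tmp => _ [F BF <-]; exists F => //.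
exact: subset_trans AB BF.
Qed.

Lemma lebesgue_outer_sigma_subadditive : sigma_subadditive lebesgue_outer.
Proof.
move=> A; have [[i ioo]|] := pselect (exists i, lebesgue_outer (A i) = +oo).
  rewrite (eseries_pinfty _ _ ioo) ?leey// => k _.
  by rewrite -ltNye (lt_le_trans _ (lebesgue_outer_ge0 _)).
rewrite -forallNE => Aoo; apply/lee_addgt0Pr => e e0.
rewrite (le_trans _ (epsilon_trick _ _ (ltW e0)))//; last first.
  by move=> k; exact: lebesgue_outer_ge0.
pose v (F : set nat * (nat -> 'rV[R]_n * 'rV[R]_n)) k := box_volume (F.2 k).1 (F.2 k).2.
pose P j F :=
  box_cover (A j) F /\
  \esum_(k in F.1) v F k <= lebesgue_outer (A j) + (e / (2 ^ j.+1)%:R)%:E.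
have [G PG] : {G & forall j, P j (G j)}.
  apply: (@choice _ _ P) => j.
  have ej : (0 < e / (2 ^ j.+1)%:R :> R)%R.
    by rewrite divr_gt0// ltr0n expn_gt0.
  have jfin : lebesgue_outer (A j) \is a fin_num.
    by rewrite ge0_fin_numE ?lebesgue_outer_ge0// ltey; exact/eqP/Aoo.
  have [_ [F AF <-] Fe] := lb_ereal_inf_adherent ej jfin.
  by exists F; split => //; exact/ltW.
have v0 F k : 0 <= v F k by exact: box_volume_ge0.
have /card_esym/ppcard_eqP[f] := card_nat2.
pose D : set nat := [set k | (G (f k).1).1 (f k).2].
pose w (p : nat * nat) := if p.2 \in (G p.1).1 then v (G p.1) p.2 else 0.
have w0 p : 0 <= w p by rewrite /w; case: ifP.
apply: (@le_trans _ _ (\esum_(p in setT) w p)).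
  apply: (@le_trans _ _ (\esum_(k in D) v (G (f k).1) (f k).2)).
    apply: ereal_inf_lbound => /=.
    exists (D, fun k => (G (f k).1).2 (f k).2) => //.
    move=> x [j _ Ajx]; have [k Gk Bx] := (PG j).1 _ Ajx.
    by exists (f^-1%FUN (j, k)); rewrite /D /= invK ?inE.
  by rewrite esum_mkcond [leRHS](reindex_esum setT setT f)//=.
rewrite (_ : esum _ _ = \sum_(i <oo) \esum_(k in (G i).1) v (G i) k); last first.
  rewrite nneseries_esumT; last by move=> i; exact: esum_ge0.
  under [RHS]eq_esum do rewrite esum_mkcond.
  rewrite (@esum_esum _ _ _ setT (fun=> setT) (fun i k => w (i, k)))//.
  rewrite (_ : _ `*`` _ = setT); last by apply/seteqP; split.
  by apply: eq_esum => -[].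
apply: lee_nneseries => [j _ _|j _]; first by apply: esum_ge0 => k _; exact: v0.
by have [] := PG j.
Qed.

HB.instance Definition _ := isOuterMeasure.Build R 'rV[R]_n lebesgue_outer
  lebesgue_outer0 lebesgue_outer_ge0 le_lebesgue_outer
  lebesgue_outer_sigma_subadditive.

End lebesgue_Rn.

(* 'rV[R]_n with the sigma-algebra of Lebesgue (i.e. Caratheodory) measurable
   sets. *)
Notation Rn R n := (caratheodory_type (@lebesgue_outer R n)).

Definition lebesgue_Rn (R : realType) (n : nat) :
    set (Rn R n) -> \bar R :=
  @lebesgue_outer R n.
HB.instance Definition _ (R : realType) (n : nat) :=
  isMeasure.Build _ _ _ (@lebesgue_Rn R n)
    (caratheodory_measure0 (@lebesgue_outer R n))
    (@caratheodory_measure_ge0 _ _ (@lebesgue_outer R n))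
    (@caratheodory_measure_sigma_additive _ _ (@lebesgue_outer R n)).

(* The half-line, in R with the sigma-algebra of Lebesgue measurable sets. *)
Definition Rpos (R : realType) :
    set (caratheodory_type (wlength (@idfun R))^*%mu) :=
  [set t : R | (0 < t)%R].

Arguments Rpos R : clear implicits.

Definition space_norm (T : Type) (R : realType) (rho : (T -> \bar R) -> \bar R)
    (f : T -> \bar R) : \bar R :=
  rho (abse \o f).

(* A function on D is represented by a total function on T; the condition
   [le_ri_norm] makes its values outside D irrelevant to an r.i. norm. *)
Section ri_spaces.
Context d (T : measurableType d) (R : realType).
Variables (mu : {measure set T -> \bar R}) (D : set T).
Implicit Types f g : T -> \bar R.

Definition mfun_ge0 f := measurable_fun D f /\ forall x, D x -> 0 <= f x.

(* f^* ; ereal_inf set0 = +oo. *)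
Definition rearr f (t : R) : \bar R :=
  ereal_inf [set l%:E | l in
    [set l : R | (0 < l)%R /\ mu (D `&` [set x | l%:E < `|f x|]) <= t%:E]].

(* f^** *)
Definition rearr_avg f (t : R) : \bar R :=
  (t^-1)%:E * \int[@completed_lebesgue_measure R]_(s in `]0%R, t[) rearr f s.

Record ri_norm (rho : (T -> \bar R) -> \bar R) : Prop := RiNorm {
  ri_norm_ge0 : forall f, mfun_ge0 f -> 0 <= rho f;
  ri_norm_eq0 : forall f, mfun_ge0 f ->
    rho f = 0 <-> {ae mu, forall x, D x -> f x = 0};
  ri_normZ : forall (a : R) f, (0 <= a)%R -> mfun_ge0 f ->
    rho (fun x => a%:E * f x) = a%:E * rho f;
  ri_normD : forall f g, mfun_ge0 f -> mfun_ge0 g ->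
    rho (f \+ g) <= rho f + rho g;
  le_ri_norm : forall f g, mfun_ge0 f -> mfun_ge0 g ->
    {ae mu, forall x, D x -> f x <= g x} -> rho f <= rho g;
  ri_norm_cvg : forall (f_ : nat -> T -> \bar R) f,
    (forall j, mfun_ge0 (f_ j)) -> mfun_ge0 f ->
    {ae mu, forall x, D x -> nondecreasing_seq (f_ ^~ x) /\
                             f_ j x @[j --> \oo] --> f x} ->
    nondecreasing_seq (rho \o f_) /\ rho (f_ j) @[j --> \oo] --> rho f;
  ri_norm_indic : forall E, measurable E -> E `<=` D -> mu E < +oo ->
    rho (fun x => (\1_E x)%:E) < +oo;
  ri_norm_local : forall E, measurable E -> E `<=` D -> mu E < +oo ->
    exists2 C : R, (0 < C)%R &
      forall f, mfun_ge0 f -> \int[mu]_(x in E) f x <= C%:E * rho f;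
  ri_norm_rearr : forall f g, mfun_ge0 f -> mfun_ge0 g ->
    (forall t, (0 < t)%R -> rearr f t = rearr g t) -> rho f = rho g
}.

Definition ri_space (rho : (T -> \bar R) -> \bar R) : set (T -> \bar R) :=
  [set f | measurable_fun D f /\ space_norm rho f < +oo].

(* op : X -> Y for the spaces X, Y determined by rX, rY. Membership of op f in Y
   only adds its measurability to the inequality. *)
Definition bounded_op (rX rY : (T -> \bar R) -> \bar R)
    (op : (T -> \bar R) -> T -> \bar R) :=
  exists2 C : R, (0 < C)%R &
    forall f, ri_space rX f ->
      ri_space rY (op f) /\ space_norm rY (op f) <= C%:E * space_norm rX f.

Definition embeds (rX rY : (T -> \bar R) -> \bar R) := bounded_op rX rY id.

End ri_spaces.

Section on_Rn.
Context (R : realType) (n : nat).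
Local Notation mu := (@lebesgue_Rn R n).

(* rY0 is the norm of the representation space over (0, +oo) of the space
   determined by rY. *)
Definition is_representation (rY : (Rn R n -> \bar R) -> \bar R)
    (rY0 : (R -> \bar R) -> \bar R) :=
  ri_norm (@completed_lebesgue_measure R) (Rpos R) rY0 /\
  forall f : Rn R n -> \bar R, measurable_fun setT f ->
    space_norm rY f = space_norm rY0 (rearr mu setT f).

(* Closed cube with lower corner a and edge length l. *)
Definition cube (a : 'rV[R]_n) (l : R) : set 'rV[R]_n :=
  [set x | forall i, (a ord0 i <= x ord0 i <= a ord0 i + l)%R].

Definition HL_max (f : Rn R n -> \bar R) (x : Rn R n) : \bar R :=
  ereal_sup [set (mu Q)^-1 * \int[mu]_(y in Q) `|f y| | Q in
    [set Q | exists a l, [/\ (0 < l)%R, Q = cube a l & Q x]]].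

End on_Rn.

Definition psi (R : realType) (t : R) : \bar R := (Num.min 1 t^-1)%:E.

(* Main.v *)
From HB Require Import structures.
From Pilot Require Import Defs.
From mathcomp Require Import all_boot all_order all_algebra.
From mathcomp Require Import all_classical all_reals all_analysis.
From mathcomp Require Import measurable_realfun.
From mathcomp Require Import lra.

(** Why the theorem holds. Write N(c) for the integral of the positive part of
    [|f| - c], denoted [excess f c] below. The functions [f] and [rearr f] have
    the same distribution, so N(c) is also the integral of the positive part of
    [rearr f - c] over the half-line, and consequently
      [rearr_avg f t] is the minimum over c >= 0 of N(c) / t + c,
    attained at c = [rearr f t] when this value is finite ([rearr_avg_le],
    [rearr_avg_eq]). The norm properties of [rho] follow from this formula and
    from those of the norm on the half-line. The triangle inequality, for
    example, holds because levels for [f] and [g] add up to a level for the sum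
    ([rearr_avgD]); [psi] is needed exactly for the finiteness of [rho] on
    indicators ([rearr_avg_indic_le]).

    Boundedness of the maximal operator is Herz's estimate
    [rearr (HL_max f) t <= 3 ^ n * rearr_avg f t] ([rearr_HL_max_le]). It comes
    from Vitali's covering argument applied to the part of [f] above the level
    c = [rearr f t] and from the minimum formula. Enlarging cubes slightly shows
    that the superlevel sets of [HL_max f] are countable unions of closed cubes,
    so that the covering argument concerns finitely many cubes only.

    For optimality, let [radial x] be the volume of the smallest centred cube
    containing [x]. The function [g := rearr f \o radial] has the same
    rearrangement as [f], hence the same norm in every rearrangement-invariant
    space, and averaging [g] over that cube gives
    [rearr_avg f (radial x) <= HL_max g x] ([rearr_avg_le_HL_max]). The left side
    is a function of [x] whose rearrangement is [rearr_avg f]. So boundedness of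
    the maximal operator on a space Z bounds [rho f] by the norm of [f] in Z
    ([rearr_avg_bounded]). Applied to the indicator of a unit cube, for which
    [rearr_avg f] dominates [psi], the same inequality shows that [psi] has
    finite norm as soon as the maximal operator is bounded on some space.

    These arguments use, on Lebesgue measure in R^n, that cubes are measurable
    and that their measure is their volume ([lebesgue_cube]). The nontrivial
    bound is obtained by integrating the indicators of a cover one coordinate at
    a time ([prod_len_le_series]). *)

Set Implicit Arguments.
Unset Strict Implicit.
Unset Printing Implicit Defensive.

Import Order.TTheory GRing.Theory Num.Theory.
Import numFieldNormedType.Exports.

Local Open Scope classical_set_scope.
Local Open Scope ring_scope.
Local Open Scope ereal_scope.

(** * Layer cake formula *)
Section layer_cake.
Context d (T : measurableType d) (R : realType).
Variable mu : {sigma_finite_measure set T -> \bar R}.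

(** Tonelli's theorem for the indicator of the region below the graph of [u]:
    its sections along the second variable are intervals of length [u x], those
    along the first one are the superlevel sets of [u]. *)
Lemma layer_cake (u : T -> \bar R) :
  measurable_fun setT u -> (forall x, 0 <= u x) ->
  \int[mu]_x u x =
  \int[lebesgue_measure]_(l in `]0%R, +oo[) mu [set x | l%:E < u x].
Proof.
move=> mu_ u0.
pose A : set (T * measurableTypeR R) :=
  [set p | (0 < p.2)%R /\ p.2%:E < u p.1].
have mA : measurable A.
  have -> : A = (setT `&` [set p | 0 < p.2%:E]) `&`
                (setT `&` [set p | p.2%:E < u p.1]).
    by rewrite !setTI; apply/seteqP; split.
  have msnd : measurable_fun setT (fun p : T * measurableTypeR R => p.2%:E).
    by apply/measurable_EFinP; exact: measurable_snd.
  apply: measurableI; apply: measurable_lte => //.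
  exact: (measurableT_comp mu_ measurable_fst).
have mf : measurable_fun setT (fun p => (\1_A p : R)%:E).
  by apply/measurable_EFinP; exact: measurable_indic.
have sec x : \int[@lebesgue_measure R]_l (\1_A (x, l) : R)%:E = u x.
  pose B : set (measurableTypeR R) := `]0%R, +oo[ `&` [set l | l%:E < u x].
  have -> : (fun l => (\1_A (x, l) : R)%:E) = (fun l => (\1_B l)%:E).
    apply/funext => l; congr (_%:E); rewrite !indicE; congr (_%:R).
    congr nat_of_bool.
    by apply/idP/idP; rewrite !inE /A /B /= in_itv/= andbT.
  case: (u x) (u0 x) @B => [r| |//] r0 B.
    have -> : B = [set` `]0%R, r[].
      apply/seteqP; split => l; rewrite /B /= !in_itv/= andbT.
        by move=> [-> ]; rewrite lte_fin.
      by move=> /andP[-> ]; rewrite lte_fin.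
    rewrite integral_indic// setIT; apply: (etrans (lebesgue_measure_itv _)).
    rewrite /= lte_fin.
    by case: ltP; rewrite ?sube0// => r0'; congr (_%:E); apply/le_anti/andP.
  have -> : B = [set` `]0%R, +oo[].
    by apply/seteqP; split => l; rewrite /B /= ?ltry // => -[].
  rewrite integral_indic// setIT; apply: (etrans (lebesgue_measure_itv _)).
  by rewrite /= ltry.
under eq_integral do rewrite -sec.
rewrite (fubini_tonelli (m2 := lebesgue_measure)
  (fun p => (\1_A p : R)%:E))//.
rewrite [RHS]integral_mkcond; apply: eq_integral => l _.
rewrite patchE; case: ifPn => [|].
  rewrite inE/= in_itv/= andbT => l0.
  rewrite -[X in mu X]setIT -integral_indic//; last first.
    by rewrite -[X in measurable X]setTI; exact: emeasurable_fun_o_infty.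
  apply: eq_integral => x _; congr (_%:E); rewrite !indicE; congr (_%:R).
  by congr nat_of_bool; apply/idP/idP; rewrite !inE /A /=; [case|].
rewrite notin_setE/= in_itv/= andbT => l0.
apply: integral0_eq => x _; rewrite indicE memNset//.
by rewrite /A /= => -[].
Qed.

End layer_cake.

(** The passage between [f] on its measure space and its rearrangement on the
    half-line: all that is needed of the two functions is that their superlevel
    sets have equal measures. *)
Lemma eq_integral_distribution d1 d2 (T1 : measurableType d1)
    (T2 : measurableType d2) (R : realType)
    (mu1 : {sigma_finite_measure set T1 -> \bar R})
    (mu2 : {sigma_finite_measure set T2 -> \bar R})
    (u : T1 -> \bar R) (v : T2 -> \bar R) :
  measurable_fun setT u -> (forall x, 0 <= u x) ->
  measurable_fun setT v -> (forall x, 0 <= v x) ->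
  (forall l : R, (0 < l)%R ->
    mu1 [set x | l%:E < u x] = mu2 [set x | l%:E < v x]) ->
  \int[mu1]_x u x = \int[mu2]_x v x.
Proof.
move=> mu_ u0 mv v0 uv; rewrite !layer_cake//; apply: eq_integral => l.
by rewrite inE/= in_itv/= andbT => /uv.
Qed.

(** * The half-line *)
Section half_line.
Context {R : realType}.
Local Notation Lebesgue_R := (caratheodory_type (wlength (@idfun R))^*%mu).
Local Notation leb := (@completed_lebesgue_measure R).

Lemma measurable_completed (A : set R) :
  measurable (A : set (measurableTypeR R)) -> measurable (A : set Lebesgue_R).
Proof. exact: sub_caratheodory. Qed.

Lemma measurable_completed_itv (i : interval R) :
  measurable ([set` i] : set Lebesgue_R).
Proof. by apply: measurable_completed; exact: measurable_itv. Qed.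

Lemma completed_lebesgue_itv0 (a : R) : (0 <= a)%R ->
  leb [set` `]0%R, a[] = a%:E.
Proof.
move=> a0; apply: (etrans (lebesgue_measure_itv _)); rewrite /= lte_fin.
by case: ltP; rewrite ?sube0// => a0'; congr (_%:E); apply/le_anti/andP.
Qed.

Lemma completed_lebesgue_itv0y : leb [set` `]0%R, +oo[] = +oo.
Proof. by apply: (etrans (lebesgue_measure_itv _)); rewrite /= ltry. Qed.

Lemma measurable_RposE : Rpos R = [set` `]0%R, +oo[].
Proof. by apply/seteqP; split => t /=; rewrite /Rpos/= in_itv/= andbT. Qed.

Lemma measurable_Rpos : measurable (Rpos R).
Proof. by rewrite measurable_RposE; exact: measurable_completed_itv. Qed.

(** The superlevel sets of a monotone function on an interval are intervals;
    this settles every measurability question on the half-line below. *)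
Lemma nonincreasing_measurable_itv (i : interval R) (h : R -> \bar R) :
  (forall s t, s \in i -> t \in i -> (s <= t)%R -> h t <= h s) ->
  measurable_fun ([set` i] : set (measurableTypeR R)) h.
Proof.
move=> hh; apply: (measurability (@ErealGenOInfty.G R)).
  exact: ErealGenOInfty.measurableE.
move=> /= _ [_ [r ->] <-].
apply: is_interval_measurable => x z [ix hx] [iz hz] y xyz.
have iy : y \in i by apply: (@interval_is_interval _ i x z).
split => //=; move: hx hz; rewrite /= !in_itv/= !andbT => _ hz.
by apply: lt_le_trans hz _; apply: hh => //; case/andP: xyz.
Qed.

Lemma nonincreasing_measurable_completed (i : interval R) (h : R -> \bar R) :
  (forall s t, s \in i -> t \in i -> (s <= t)%R -> h t <= h s) ->
  measurable_fun ([set` i] : set Lebesgue_R) h.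
Proof.
move=> /nonincreasing_measurable_itv mh mi Y mY.
by apply: measurable_completed; apply: mh => //; exact: measurable_itv.
Qed.

Lemma ae_Rpos_exists (P : R -> Prop) : {ae leb, forall t, Rpos R t -> P t} ->
  exists2 t, (0 < t)%R & P t.
Proof.
move=> [N [mN N0 subN]]; apply: contrapT => /forall2NP noP.
have : leb (Rpos R) <= 0.
  rewrite -N0; apply: le_measure; rewrite ?inE//; first exact: measurable_Rpos.
  move=> t t0; apply: subN => /(_ t0) Pt; have [|] := noP t; first exact.
  by move/(_ Pt).
by rewrite measurable_RposE completed_lebesgue_itv0y.
Qed.

Lemma mfun_psi : mfun_ge0 (Rpos R) (@psi R).
Proof.
split=> [|t t0]; last first.
  by rewrite lee_fin le_min ler01 invr_ge0 ltW.
rewrite measurable_RposE; apply: nonincreasing_measurable_completed => s t.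
rewrite !in_itv/= !andbT => s0 t0 st; rewrite lee_fin; apply: le_min2 => //.
by rewrite lef_pV2.
Qed.

End half_line.

(** * Rearrangements and their averages *)
Lemma measure_bigcup_le d (T : measurableType d) (R : realType)
    (mu : {measure set T -> \bar R}) (A : (set T)^nat) (c : \bar R) :
  (forall k, measurable (A k)) -> nondecreasing_seq A ->
  (forall k, mu (A k) <= c) -> mu (\bigcup_k A k) <= c.
Proof.
move=> mA ndA Ac.
have cvgA := nondecreasing_cvg_mu (mu := mu) mA (bigcupT_measurable _ mA) ndA.
by apply: (cvge_le _ cvgA); exact: nearW.
Qed.

Section rearrangement.
Context d (T : measurableType d) (R : realType).
Variable mu : {sigma_finite_measure set T -> \bar R}.
Implicit Types (f g : T -> \bar R) (t l c : R).
Local Notation leb := (@completed_lebesgue_measure R).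
Local Notation rearr := (rearr mu setT).
Local Notation rearr_avg := (rearr_avg mu setT).

Definition distr f l : \bar R := mu [set x | l%:E < `|f x|].

(** The L^1 distance from [f] to the functions bounded by [c], for [c >= 0]; its
    trade-off with [c] is the K-functional of the couple (L^1, L^oo). *)
Definition excess f c : \bar R := \int[mu]_x maxe (`|f x| - c%:E) 0.

Lemma rearrE f t : rearr f t =
  ereal_inf [set l%:E | l in [set l | (0 < l)%R /\ distr f l <= t%:E]].
Proof. by rewrite /rearr /distr; under eq_set do rewrite setTI. Qed.

Lemma rearr_ge0 f t : 0 <= rearr f t.
Proof.
by rewrite rearrE; apply: le_ereal_inf_tmp => _ [l [l0 _] <-]; rewrite lee_fin ltW.
Qed.

Lemma abse_rearr f : abse \o rearr f = rearr f.
Proof. by apply/funext => t /=; rewrite gee0_abs// rearr_ge0. Qed.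

Lemma rearr_abse f : rearr (abse \o f) = rearr f.
Proof.
apply/funext => t; rewrite !rearrE /distr.
by under eq_set do under eq_set do rewrite /= abse_id.
Qed.

Lemma rearr_nonincreasing f s t : (s <= t)%R -> rearr f t <= rearr f s.
Proof.
move=> st; rewrite !rearrE; apply/ereal_inf_le_tmp => _ [l [l0 fl] <-].
by exists l => //; split => //; apply: (le_trans fl); rewrite lee_fin.
Qed.

Lemma measurable_superlevel f l : measurable_fun setT f ->
  measurable [set x | l%:E < `|f x|].
Proof.
move=> mf; rewrite -[X in measurable X]setTI.
by apply: emeasurable_fun_o_infty => //; exact: measurableT_comp.
Qed.

Lemma distr_nonincreasing f l m : measurable_fun setT f -> (l <= m)%R ->
  distr f m <= distr f l.
Proof.
move=> mf lm; apply: le_measure; rewrite ?inE; try exact: measurable_superlevel.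
by move=> x /=; apply: le_lt_trans; rewrite lee_fin.
Qed.

Lemma rearr_le f l t : measurable_fun setT f -> (0 <= l)%R ->
  distr f l <= t%:E -> rearr f t <= l%:E.
Proof.
move=> mf l0 flt; apply/lee_addgt0Pr => e e0; rewrite rearrE.
apply: ereal_inf_lbound; exists (l + e)%R => //; split; first by lra.
by apply: le_trans flt; apply: distr_nonincreasing => //; lra.
Qed.

(** The set where [|f| > l] is the increasing union of those where
    [|f| > l + 1 / (k + 1)], so the distribution function is continuous from the
    right in the sense needed to invert it. *)
Lemma distr_right_lsc f l t : measurable_fun setT f -> t%:E < distr f l ->
  exists2 m, (l < m)%R & t%:E < distr f m.
Proof.
move=> mf; apply: contraPP => /forall2NP h; apply/negP; rewrite -leNgt.
pose A k := [set x | (l + k.+1%:R^-1)%:E < `|f x|].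
have mA k : measurable (A k) by exact: measurable_superlevel.
have -> : distr f l = mu (\bigcup_k A k).
  congr (mu _); apply/seteqP; split => x /=; last first.
    move=> [k _]; rewrite /A/=; apply: lt_trans; rewrite lte_fin ltrDl.
    by rewrite invr_gt0.
  move=> lfx; have [fxoo|fxoo] := eqVneq `|f x| +oo.
    by exists O => //; rewrite /A/= fxoo ltry.
  have fx : `|f x| \is a fin_num by rewrite ge0_fin_numE// lt_neqAle fxoo leey.
  move: lfx; rewrite -(fineK fx) lte_fin => /ltr_add_invr[k hk].
  by exists k => //; rewrite /A/= -(fineK fx) lte_fin.
apply: measure_bigcup_le => // [m n mn|k].
  apply/subsetPset => x; rewrite /A/=; apply: le_lt_trans.
  by rewrite lee_fin lerD2l lef_pV2 ?posrE// ler_nat.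
have [hl|] := h (l + k.+1%:R^-1)%R; first by case: hl; rewrite ltrDl invr_gt0.
by move/negP; rewrite -leNgt.
Qed.

(** The rearrangement is the generalized inverse of the distribution function;
    this exchange of the two variables is how every property of the former is
    read off from the latter. *)
Lemma lt_rearr f l t : measurable_fun setT f -> (0 <= l)%R ->
  (l%:E < rearr f t) = (t%:E < distr f l).
Proof.
move=> mf l0; apply/idP/idP; apply: contraTT; rewrite -!leNgt.
  exact: rearr_le.
apply: contraTT; rewrite -!ltNge => /(distr_right_lsc mf)[m lm tm].
apply: (@lt_le_trans _ _ m%:E); first by rewrite lte_fin.
rewrite rearrE; apply: le_ereal_inf_tmp => _ [k [k0 fk] <-].
rewrite lee_fin leNgt; apply/negP => km; move: tm; apply/negP; rewrite -leNgt.
by apply: le_trans fk; apply: distr_nonincreasing => //; exact: ltW.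
Qed.

(** Right continuity, for a nonincreasing function, amounts to the superlevel
    sets being open on the right. *)
Lemma rearr_right_lsc f l t : measurable_fun setT f -> (0 <= l)%R ->
  l%:E < rearr f t -> exists2 s, (t < s)%R & l%:E < rearr f s.
Proof.
move=> mf l0; rewrite lt_rearr//; case E : (distr f l) => [r| |//].
  rewrite lte_fin => tr; exists ((t + r) / 2)%R; first lra.
  by rewrite lt_rearr// E lte_fin; lra.
by exists (t + 1)%R; [lra|rewrite lt_rearr// E ltry].
Qed.

Lemma measurable_rearr f (i : interval R) :
  measurable_fun ([set` i] : set (caratheodory_type (wlength (@idfun R))^*%mu))
    (rearr f).
Proof.
apply: nonincreasing_measurable_completed => s t _ _; exact: rearr_nonincreasing.
Qed.

Let excess_fun_ge0 (x : \bar R) : 0 <= maxe x 0.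
Proof. by rewrite le_max lexx orbT. Qed.

Let lt_excess_fun (x : \bar R) c l : (0 < l)%R ->
  (l%:E < maxe (x - c%:E) 0) = ((l + c)%:E < x).
Proof.
by move=> l0; rewrite lt_max lteBrDr// -EFinD lte_fin [(l < 0)%R]ltNge ltW//= orbF.
Qed.

Lemma measurable_excess_fun f c : measurable_fun setT f ->
  measurable_fun setT (fun x => maxe (`|f x| - c%:E) 0).
Proof.
move=> mf; apply: measurable_maxe => //; apply: emeasurable_funB => //.
exact: measurableT_comp.
Qed.

Lemma measurable_excess_rearr f c (i : interval R) :
  measurable_fun ([set` i] : set (caratheodory_type (wlength (@idfun R))^*%mu))
    (fun s => maxe (rearr f s - c%:E) 0).
Proof.
apply: nonincreasing_measurable_completed => s t _ _ st.
by apply: le_max2 => //; apply: leeD2r; exact: rearr_nonincreasing.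
Qed.

Lemma excess_ge0 f c : 0 <= excess f c.
Proof. by apply: integral_ge0 => x _; exact: excess_fun_ge0. Qed.

(** Equimeasurability of [f] and its rearrangement survives truncation from
    below at height [c], since truncation only shifts the distribution
    function. *)
Lemma excess_rearr f c : measurable_fun setT f -> (0 <= c)%R ->
  excess f c = \int[leb]_(s in `]0%R, +oo[) maxe (rearr f s - c%:E) 0.
Proof.
move=> mf c0; rewrite integral_mkcond.
apply: eq_integral_distribution.
- exact: measurable_excess_fun.
- by move=> x; exact: excess_fun_ge0.
- apply/(measurable_restrictT _ (measurable_completed_itv _)).
  exact: measurable_excess_rearr.
- by move=> s; rewrite patchE; case: ifP => // _; exact: excess_fun_ge0.
move=> l l0; under eq_set do rewrite lt_excess_fun//.
rewrite -/(distr f (l + c)).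
have lc0 : (0 <= l + c)%R by lra.
have -> : [set s | l%:E < ((fun s => maxe (rearr f s - c%:E) 0) \_ `]0%R, +oo[) s]
    = [set s | (0 < s)%R /\ s%:E < distr f (l + c)].
  apply/seteqP; split => s /=; rewrite patchE.
    case: ifPn => [|_]; last by rewrite lte_fin ltNge ltW.
    rewrite inE/= in_itv/= andbT => s0; rewrite lt_excess_fun// lt_rearr//.
  by case=> s0; rewrite mem_set/= ?in_itv/= ?s0// lt_excess_fun// lt_rearr.
case: (distr f (l + c)) (measure_ge0 mu _ : 0 <= distr f (l + c)) => [r r0| _|//].
  apply: esym; apply: etrans (completed_lebesgue_itv0 (r0 : (0 <= r)%R)).
  congr (leb _); apply/seteqP; split => s; rewrite /= in_itv/= lte_fin.
    by case=> -> ->.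
  by move=> /andP[].
apply: esym; apply: etrans completed_lebesgue_itv0y; congr (leb _).
apply/seteqP; split => s; rewrite /= in_itv/= andbT ?ltry; first by case.
by [].
Qed.

Lemma integral_excess_rearrD f c t : (0 < t)%R -> (0 <= c)%R ->
  \int[leb]_(s in `]0%R, t[) (maxe (rearr f s - c%:E) 0 + c%:E)
    = \int[leb]_(s in `]0%R, t[) maxe (rearr f s - c%:E) 0 + (c * t)%:E.
Proof.
move=> t0 c0; rewrite ge0_integralD.
- congr (_ + _); apply: (etrans (integral_cst _ _ _)).
    exact: measurable_completed_itv.
  by rewrite EFinM; congr (_ * _); apply: completed_lebesgue_itv0; exact: ltW.
- exact: measurable_completed_itv.
- by move=> s _; exact: excess_fun_ge0.
- exact: measurable_excess_rearr.
- by move=> s _; rewrite lee_fin.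
- exact: measurable_cst.
Qed.

Let avg_excessE f c t : (0 <= c)%R -> (0 < t)%R ->
  (t^-1)%:E * excess f c + c%:E = (t^-1)%:E * (excess f c + (c * t)%:E).
Proof.
move=> c0 t0; rewrite (@ge0_muleDr _ _ (excess f c)) ?excess_ge0//; last first.
  by rewrite lee_fin mulr_ge0// ltW.
by rewrite -EFinM mulrCA mulVf ?mulr1// gt_eqF.
Qed.

(** Together with [rearr_avg_eq] this says that, as a function of [f] and [t],
    the average of the rearrangement is the minimum over [c] of
    [excess f c / t + c]. On [0, t] the rearrangement is at most [c] plus its
    excess over [c]. *)
Lemma rearr_avg_le f c t : measurable_fun setT f -> (0 <= c)%R -> (0 < t)%R ->
  rearr_avg f t <= (t^-1)%:E * excess f c + c%:E.
Proof.
move=> mf c0 t0.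
rewrite avg_excessE//.
apply: lee_wpmul2l; first by rewrite lee_fin invr_ge0 ltW.
apply: (@le_trans _ _
    (\int[leb]_(s in `]0%R, t[) (maxe (rearr f s - c%:E) 0 + c%:E))).
  apply: ge0_le_integral.
  - exact: measurable_completed_itv.
  - by move=> s _; exact: rearr_ge0.
  - exact: measurable_rearr.
  - apply: nonincreasing_measurable_completed => s r _ _ sr.
    apply: leeD2r; apply: le_max2 => //; apply: leeD2r.
    exact: rearr_nonincreasing.
  - by move=> s _; rewrite -leeBlDr// le_max lexx.
rewrite integral_excess_rearrD// leeD2r// excess_rearr//.
apply: ge0_subset_integral.
- exact: measurable_completed_itv.
- exact: measurable_completed_itv.
- exact: measurable_excess_rearr.
- by move=> s _; exact: excess_fun_ge0.
- by apply: subset_itvl; rewrite bnd_simp.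
Qed.

(** The minimum is attained at the value of the rearrangement at [t], because
    the excess over this value is concentrated on [0, t]. *)
Lemma rearr_avg_eq f c t : measurable_fun setT f -> (0 < t)%R ->
  rearr f t = c%:E -> rearr_avg f t = (t^-1)%:E * excess f c + c%:E.
Proof.
move=> mf t0 ftc; have c0 : (0 <= c)%R by rewrite -lee_fin -ftc rearr_ge0.
rewrite avg_excessE//.
congr (_ * _).
have -> : excess f c = \int[leb]_(s in `]0%R, t[) maxe (rearr f s - c%:E) 0.
  rewrite excess_rearr// integral_mkcond [RHS]integral_mkcond.
  congr (integral _ _ _); apply/funext => s; rewrite !patchE.
  case: (ltrP 0%R s) => s0; last first.
    by rewrite !memNset//= in_itv/= ltNge s0.
  rewrite mem_set/= ?in_itv/= ?s0//; case: (ltrP s t) => st.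
    by rewrite mem_set//= in_itv/= s0 st.
  rewrite memNset/= ?in_itv/= ?s0 ?ltNge ?st//.
  change (maxe (rearr f s - c%:E) 0 = 0).
  by apply/max_idPr; rewrite leeBlDr// add0e -ftc rearr_nonincreasing.
rewrite -integral_excess_rearrD//; apply: eq_integral => s.
rewrite inE/= in_itv/= => /andP[s0 st].
have cs : 0 <= rearr f s - c%:E.
  by rewrite leeBrDr// add0e -ftc; exact/rearr_nonincreasing/ltW.
by rewrite (max_idPl cs) subeK.
Qed.

Lemma rearr_avgy f t : (0 < t)%R -> rearr f t = +oo -> rearr_avg f t = +oo.
Proof.
move=> t0 fty; rewrite /rearr_avg (eq_integral (cst +oo)); last first.
  move=> s; rewrite inE/= in_itv/= => /andP[s0 st]; apply/eqP.
  by rewrite -leye_eq -fty rearr_nonincreasing// ltW.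
rewrite integral_cst; last exact: measurable_completed_itv.
rewrite gt0_mulye ?gt0_muley ?lte_fin ?invr_gt0//.
apply: (@lt_le_trans _ _ t%:E); first by rewrite lte_fin.
by rewrite -(completed_lebesgue_itv0 (ltW t0)).
Qed.

(** The form in which the minimum formula is applied: an upper bound for an
    average is proved by inserting the optimal [c] of a dominating quantity. *)
Lemma rearr_avgP f t : measurable_fun setT f -> (0 < t)%R ->
  rearr_avg f t = +oo \/
  exists c, [/\ (0 <= c)%R, rearr f t = c%:E &
    rearr_avg f t = (t^-1)%:E * excess f c + c%:E].
Proof.
move=> mf t0; case E : (rearr f t) (rearr_ge0 f t) => [c| |//].
  by move=> c0; right; exists c; split => //; exact: rearr_avg_eq.
by move=> _; left; exact: rearr_avgy.
Qed.

Lemma rearr_avg_ge0 f t : (0 < t)%R -> 0 <= rearr_avg f t.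
Proof.
move=> t0; apply: mule_ge0; first by rewrite lee_fin invr_ge0 ltW.
by apply: integral_ge0 => s _; exact: rearr_ge0.
Qed.

Lemma rearr_avg_nonincreasing f s t : measurable_fun setT f -> (0 < s)%R ->
  (s <= t)%R -> rearr_avg f t <= rearr_avg f s.
Proof.
move=> mf s0 st; have t0 := lt_le_trans s0 st.
have [->|[c [c0 _ ->]]] := rearr_avgP mf s0; first exact: leey.
apply: (le_trans (rearr_avg_le mf c0 t0)); apply: leeD2r.
by apply: lee_wpmul2r; [exact: excess_ge0|rewrite lee_fin lef_pV2].
Qed.

Lemma le_excess_ae f g c : measurable_fun setT f -> measurable_fun setT g ->
  {ae mu, forall x, setT x -> `|f x| <= `|g x|} -> excess f c <= excess g c.
Proof.
move=> mf mg fg; apply: ae_ge0_le_integral => //.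
- exact: measurable_excess_fun.
- exact: measurable_excess_fun.
- apply: filterS fg => x fg _; apply: le_max2 => //.
  by apply: leeD2r; exact: fg.
Qed.

Lemma le_rearr_avg_ae f g t : measurable_fun setT f -> measurable_fun setT g ->
  {ae mu, forall x, setT x -> `|f x| <= `|g x|} -> (0 < t)%R ->
  rearr_avg f t <= rearr_avg g t.
Proof.
move=> mf mg fg t0; have [->|[c [c0 _ ->]]] := rearr_avgP mg t0.
  exact: leey.
apply: (le_trans (rearr_avg_le mf c0 t0)); apply: leeD2r.
apply: lee_wpmul2l; first by rewrite lee_fin invr_ge0 ltW.
exact: le_excess_ae.
Qed.

Lemma excessD f g b c : measurable_fun setT f -> measurable_fun setT g ->
  excess (f \+ g) (b + c) <= excess f b + excess g c.
Proof.
move=> mf mg; rewrite /excess -ge0_integralD//; last 2 first.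
- exact: measurable_excess_fun.
- exact: measurable_excess_fun.
apply: ge0_le_integral => //.
- by apply: measurable_excess_fun; exact: emeasurable_funD.
- by apply: emeasurable_funD; exact: measurable_excess_fun.
move=> x _; rewrite ge_max adde_ge0// andbT.
apply: (@le_trans _ _ ((`|f x| - b%:E) + (`|g x| - c%:E))).
  rewrite addeACA -!EFinN -EFinD -opprD; apply: leeD2r.
  exact: lee_abs_add.
by apply: leeD; rewrite le_max lexx.
Qed.

(** The triangle inequality comes from the minimum formula: the optimal levels
    [b] of [f] and [c] of [g] give the admissible level [b + c] for the sum. This
    avoids choosing sets of prescribed measure. *)
Lemma rearr_avgD f g t : measurable_fun setT f -> measurable_fun setT g ->
  (0 < t)%R -> rearr_avg (f \+ g) t <= rearr_avg f t + rearr_avg g t.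
Proof.
move=> mf mg t0.
have [->|[b [b0 _ ->]]] := rearr_avgP mf t0.
  by rewrite addye ?leey// -ltNye (lt_le_trans _ (rearr_avg_ge0 _ t0)).
have [->|[c [c0 _ ->]]] := rearr_avgP mg t0.
  rewrite addey ?leey// -ltNye (@lt_le_trans _ _ 0)// adde_ge0// mule_ge0//.
    by rewrite lee_fin invr_ge0 ltW.
  exact: excess_ge0.
have bc0 := addr_ge0 b0 c0.
have mfg : measurable_fun setT (f \+ g) by exact: emeasurable_funD.
apply: (le_trans (rearr_avg_le mfg bc0 t0)).
rewrite addeACA -EFinD; apply: leeD2r.
rewrite -(@ge0_muleDr _ _ (excess f b)) ?excess_ge0//.
apply: lee_wpmul2l; first by rewrite lee_fin invr_ge0 ltW.
exact: excessD.
Qed.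

Lemma excessZ f (a : R) c : measurable_fun setT f -> (0 <= a)%R ->
  excess (fun x => a%:E * f x) (a * c) = a%:E * excess f c.
Proof.
move=> mf a0; rewrite /excess -ge0_integralZl//; last exact: measurable_excess_fun.
apply: eq_integral => x _; rewrite maxe_pMr// mule0 abseM gee0_abs//.
by rewrite muleBr// fin_num_adde_defl.
Qed.

(* One inequality suffices: the other one is this one for the inverse factor. *)
Let rearr_avgZ_le f (a : R) t : measurable_fun setT f -> (0 < a)%R -> (0 < t)%R ->
  rearr_avg (fun x => a%:E * f x) t <= a%:E * rearr_avg f t.
Proof.
move=> mf a0 t0; have [->|[c [c0 _ ->]]] := rearr_avgP mf t0.
  by rewrite gt0_muley// leey.
have maf : measurable_fun setT (fun x => a%:E * f x) by exact: measurable_funeM.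
apply: (le_trans (rearr_avg_le maf (mulr_ge0 (ltW a0) c0) t0)).
rewrite (excessZ c mf (ltW a0)) (@ge0_muleDr _ _ (_ * excess f c)) ?lee_fin//; last first.
  by rewrite mule_ge0 ?excess_ge0// lee_fin invr_ge0 ltW.
by rewrite EFinM muleCA.
Qed.

Lemma rearr_avgZ f (a : R) t : measurable_fun setT f -> (0 <= a)%R -> (0 < t)%R ->
  rearr_avg (fun x => a%:E * f x) t = a%:E * rearr_avg f t.
Proof.
move=> mf; rewrite le_eqVlt => /predU1P[<-|a0] t0; apply/eqP; rewrite eq_le.
  rewrite mul0e rearr_avg_ge0// andbT.
  under [X in rearr_avg X _]eq_fun do rewrite mul0e.
  apply: (le_trans (rearr_avg_le (measurable_cst _) (lexx 0%R) t0)).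
  rewrite adde0 /excess integral0_eq ?mule0// => x _.
  by rewrite abse0 sube0 maxxx.
rewrite rearr_avgZ_le//=.
have maf : measurable_fun setT (fun x => a%:E * f x) by exact: measurable_funeM.
have a0' : (0 < a^-1)%R by rewrite invr_gt0.
have := rearr_avgZ_le maf a0' t0.
have -> : (fun x => (a^-1)%:E * (a%:E * f x)) = f.
  by apply/funext => x; rewrite muleA -EFinM mulVf ?gt_eqF// mul1e.
move=> /(lee_wpmul2l (x := a%:E)); rewrite lee_fin => /(_ (ltW a0)) h.
apply: (le_trans h).
by rewrite muleA -EFinM divff ?gt_eqF// mul1e.
Qed.

Lemma rearr_avg_eq0 f t : measurable_fun setT f -> (0 < t)%R ->
  rearr_avg f t = 0 -> {ae mu, forall x, setT x -> f x = 0}.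
Proof.
move=> mf t0; have [->//|[c [c0 _ ->]]] := rearr_avgP mf t0.
have tE : 0 <= (t^-1)%:E * excess f c.
  by rewrite mule_ge0 ?excess_ge0// lee_fin invr_ge0 ltW.
move=> /eqP; rewrite padde_eq0 ?lee_fin// => /andP[/eqP tE0 /eqP[c0']].
move: tE0; rewrite c0' => /eqP; rewrite mule_eq0 eqe invr_eq0 (gt_eqF t0)/=.
rewrite /excess => /eqP E0; apply/(ae_eq_integral_abs mu measurableT mf).
rewrite -E0; apply: eq_integral => x _.
by rewrite sube0; apply/esym/max_idPl.
Qed.

Lemma rearr_avg_ae0 f t : measurable_fun setT f -> (0 < t)%R ->
  {ae mu, forall x, setT x -> f x = 0} -> rearr_avg f t = 0.
Proof.
move=> mf t0 f0; apply/eqP; rewrite eq_le rearr_avg_ge0// andbT.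
rewrite -(mul0e (rearr_avg f t)) -rearr_avgZ//; apply: le_rearr_avg_ae => //.
  exact: measurable_funeM.
by apply: filterS f0 => x f0 _; rewrite f0// mule0.
Qed.

(** The Hardy--Littlewood inequality for an indicator, in the form required by
    the local integrability property of the norm. *)
Lemma integral_le_rearr_avg f (E : set T) (m : R) : measurable_fun setT f ->
  measurable E -> mu E <= m%:E -> (0 < m)%R ->
  \int[mu]_(x in E) `|f x| <= m%:E * rearr_avg f m.
Proof.
move=> mf mE Em m0; have [->|[c [c0 _ ->]]] := rearr_avgP mf m0.
  by rewrite gt0_muley ?leey.
rewrite (@ge0_muleDr _ _ (_ * excess f c)) ?lee_fin//; last first.
  by rewrite mule_ge0 ?excess_ge0// lee_fin invr_ge0 ltW.
rewrite muleA -EFinM divff ?gt_eqF// mul1e.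
have mfE : measurable_fun E f by exact: measurable_funTS.
have mexE : measurable_fun E (fun x => maxe (`|f x| - c%:E) 0).
  by apply: measurable_funTS; exact: measurable_excess_fun.
apply: (@le_trans _ _ (\int[mu]_(x in E) (maxe (`|f x| - c%:E) 0 + c%:E))).
  apply: ge0_le_integral => //; first exact: measurableT_comp.
    exact: emeasurable_funD.
  by move=> x _; rewrite -leeBlDr// le_max lexx.
rewrite ge0_integralD// muleC; apply: leeD.
  by apply: ge0_subset_integral => //; exact: measurable_excess_fun.
have -> : \int[mu]_(x in E) c%:E = c%:E * mu E by exact: integral_cst.
exact: lee_wpmul2l.
Qed.

(** Averages decrease slowly, by at most the factor [t / s] from [t] to [s], so
    a strict lower bound at [t] persists slightly to the right. *)
Lemma rearr_avg_right_lsc f l t : measurable_fun setT f -> (0 <= l)%R ->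
  (0 < t)%R -> l%:E < rearr_avg f t ->
  exists2 s, (t < s)%R & l%:E < rearr_avg f s.
Proof.
move=> mf l0 t0 lt.
have fts s : (t <= s)%R -> (t / s)%:E * rearr_avg f t <= rearr_avg f s.
  move=> ts; have s0 := lt_le_trans t0 ts.
  rewrite /Pilot.Defs.rearr_avg muleA -EFinM mulrAC divff ?gt_eqF// mul1r.
  apply: lee_wpmul2l; first by rewrite lee_fin invr_ge0 ltW.
  apply: ge0_subset_integral.
  - exact: measurable_completed_itv.
  - exact: measurable_completed_itv.
  - exact: measurable_rearr.
  - by move=> r _; exact: rearr_ge0.
  - by apply: subset_itvl; rewrite bnd_simp.
case E : (rearr_avg f t) lt => [r| |//]; last first.
  move=> _; exists (t + 1)%R; first lra.
  apply: lt_le_trans (fts _ _); last lra.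
  by rewrite E gt0_muley ?ltry// lte_fin divr_gt0//; lra.
rewrite lte_fin => lr; have r0 : (0 < r)%R by lra.
(* With this point the factor [t / s] lowers the value [r] to [(l + r) / 2]. *)
exists (t * (2 * r / (l + r)))%R.
  by rewrite ltr_pMr// ltr_pdivlMr; lra.
apply: lt_le_trans (fts _ _); last first.
  by rewrite ler_peMr ?ltW// ltr_pdivlMr; lra.
rewrite E -EFinM lte_fin invfM mulrA divff ?gt_eqF// mul1r invf_div.
by rewrite mulrAC ltr_pdivlMr; nra.
Qed.

Lemma measurable_rearr_avg f : measurable_fun setT f ->
  measurable_fun (Rpos R) (rearr_avg f).
Proof.
move=> mf; rewrite measurable_RposE.
apply: nonincreasing_measurable_completed => s t.
by rewrite !in_itv/= !andbT => s0 _ st; exact: rearr_avg_nonincreasing.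
Qed.

Lemma eq_rearr_avg f g t :
  (forall s, (0 < s)%R -> rearr f s = rearr g s) ->
  rearr_avg f t = rearr_avg g t.
Proof.
move=> fg; congr (_ * _); apply: eq_integral => s.
by rewrite inE/= in_itv/= => /andP[/fg].
Qed.

Lemma rearr_avg_abse f : rearr_avg (abse \o f) = rearr_avg f.
Proof. by apply/funext => t; apply: eq_rearr_avg => s _; rewrite rearr_abse. Qed.

Lemma abse_rearr_avg f : abse \o rearr_avg f = rearr_avg f.
Proof.
apply/funext => t /=; have [t0|t0] := leP t 0%R.
  rewrite /Pilot.Defs.rearr_avg set_itv_ge ?integral_set0 ?mule0 ?abse0//.
  by rewrite bnd_simp -leNgt.
by rewrite gee0_abs// rearr_avg_ge0.
Qed.

(** When [Q] collects the largest values of [g], the Hardy--Littlewood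
    inequality on [Q] is sharp: the excess over the common threshold vanishes
    outside [Q]. *)
Lemma rearr_avg_le_integral g (Q : set T) (s : R) : measurable_fun setT g ->
  measurable Q -> mu Q = s%:E -> (0 < s)%R ->
  (forall y, Q y -> rearr g s <= `|g y|) ->
  (forall y, ~ Q y -> `|g y| <= rearr g s) ->
  s%:E * rearr_avg g s <= \int[mu]_(y in Q) `|g y|.
Proof.
move=> mg mQ Qs s0 gQ gNQ.
case E : (rearr g s) (rearr_ge0 g s) => [c| |//]; last first.
  move=> _; rewrite (eq_integral (cst +oo)); last first.
    by move=> y; rewrite inE => yQ; apply/eqP; rewrite -leye_eq -E gQ.
  have -> : \int[mu]_(y in Q) cst +oo y = +oo; last exact: leey.
  have -> : \int[mu]_(y in Q) cst +oo y = +oo * s%:E.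
    by rewrite -Qs; exact: integral_cst.
  by rewrite gt0_mulye ?lte_fin.
rewrite lee_fin => c0; rewrite (rearr_avg_eq mg s0 E) avg_excessE// muleA -EFinM.
rewrite divff ?gt_eqF// mul1e.
have -> : excess g c = \int[mu]_(y in Q) maxe (`|g y| - c%:E) 0.
  rewrite [RHS]integral_mkcond; apply: eq_integral => y _; rewrite patchE.
  case: ifPn => // /negP yQ; apply/max_idPr; rewrite leeBlDr// add0e -E.
  by apply: gNQ => Qy; apply: yQ; rewrite inE.
have -> : (c * s)%:E = \int[mu]_(y in Q) c%:E.
  by rewrite EFinM -Qs; apply/esym; exact: integral_cst.
rewrite -ge0_integralD//; last first.
  by apply: measurable_funTS; exact: measurable_excess_fun.
rewrite le_eqVlt; apply/orP; left; apply/eqP; apply: eq_integral => y.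
rewrite inE => Qy.
have cy : 0 <= `|g y| - c%:E by rewrite leeBrDr// add0e -E gQ.
by rewrite (max_idPl cy) subeK.
Qed.

Lemma measure_negligibleU_le (A B N : set T) : measurable A -> measurable B ->
  measurable N -> mu N = 0 -> A `<=` B `|` N -> mu A <= mu B.
Proof.
move=> mA mB mN N0 AB; apply: (@le_trans _ _ (mu (B `|` N))).
  by apply: le_measure => //; rewrite inE//; exact: measurableU.
by rewrite measureU0.
Qed.

Lemma le_rearr_ae f g t : measurable_fun setT f -> measurable_fun setT g ->
  {ae mu, forall x, setT x -> `|f x| <= `|g x|} -> rearr f t <= rearr g t.
Proof.
move=> mf mg [N [mN N0 fgN]]; rewrite !rearrE; apply/ereal_inf_le_tmp.
move=> _ [l [l0 gl] <-]; exists l => //; split => //; apply: le_trans gl.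
apply: measure_negligibleU_le N0 _ => //; try exact: measurable_superlevel.
move=> x /= fx; have [Nx|Nx] := pselect (N x); [by right|left => /=].
apply: (lt_le_trans fx); apply: contrapT => fgx; apply: Nx; apply: fgN.
by move/(_ Logic.I).
Qed.

(** The Fatou property: distribution functions increase along with the
    functions by continuity of the measure, inverting them carries this over to
    the rearrangements, and monotone convergence to the averages. *)
Section increasing.
Variables (f_ : nat -> T -> \bar R) (f : T -> \bar R).
Hypothesis mf_ : forall j, measurable_fun setT (f_ j).
Hypothesis mf : measurable_fun setT f.
Hypothesis ff : {ae mu, forall x, setT x ->
  nondecreasing_seq (fun j => `|f_ j x|) /\
  `|f_ j x| @[j --> \oo] --> `|f x|}.

Let lt_distr_sup l t : t%:E < distr f l -> exists j, t%:E < distr (f_ j) l.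
Proof.
apply: contraPP => /forallNP h; apply/negP; rewrite -leNgt.
have [N [mN N0 subN]] := ff.
have goodN x : ~ N x -> nondecreasing_seq (fun j => `|f_ j x|) /\
    `|f_ j x| @[j --> \oo] --> `|f x|.
  by move=> Nx; apply: contrapT => bad; apply: Nx; apply: subN => /(_ Logic.I).
pose A j := [set x | l%:E < `|f_ j x|] `\` N.
have mA j : measurable (A j).
  by apply: measurableD => //; exact: measurable_superlevel.
apply: (@le_trans _ _ (mu (\bigcup_j A j))).
  apply: measure_negligibleU_le N0 _ => //; first exact: measurable_superlevel.
    exact: bigcupT_measurable.
  move=> x /= fx; have [Nx|Nx] := pselect (N x); [by right|left].
  apply: contrapT => nA; move: fx; apply/negP; rewrite -leNgt.
  apply: (cvge_le _ (goodN x Nx).2); apply: nearW => j; rewrite leNgt.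
  by apply/negP => fj; apply: nA; exists j.
apply: measure_bigcup_le => // [i j ij|j].
  apply/subsetPset => x [/= fi Nx]; split => //=; apply: (lt_le_trans fi).
  exact: (goodN x Nx).1.
apply: (@le_trans _ _ (distr (f_ j) l)).
  by apply: le_measure; rewrite ?inE//; [exact: measurable_superlevel|exact: subIsetl].
by rewrite leNgt; exact/negP/h.
Qed.

Lemma nondecreasing_rearr s : nondecreasing_seq (fun j => rearr (f_ j) s).
Proof.
move=> i j ij; apply: le_rearr_ae => //.
by apply: filterS ff => x fx xT; exact: (fx xT).1.
Qed.

Lemma cvg_rearr s : rearr (f_ j) s @[j --> \oo] --> rearr f s.
Proof.
suff -> : rearr f s = ereal_sup (range (fun j => rearr (f_ j) s)).
  exact/ereal_nondecreasing_cvgn/nondecreasing_rearr.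
apply/eqP; rewrite eq_le; apply/andP; split; last first.
  apply: ge_ereal_sup => _ [j _ <-]; apply: le_rearr_ae => //.
  apply: filterS ff => x fx xT; have [nd cvgx] := fx xT.
  by apply: (cvge_ge _ cvgx); exists j => // k; exact: nd.
rewrite leNgt; apply/negP => lt_sup.
have sup_ge j : rearr (f_ j) s <= ereal_sup (range (fun j => rearr (f_ j) s)).
  by apply: ereal_sup_ubound; exists j.
move: lt_sup sup_ge (le_trans (rearr_ge0 (f_ 0%N) s) (sup_ge 0%N)).
case: ereal_sup => [a| |]//; last by rewrite ltNge leey.
rewrite lee_fin => lt_a le_a a0; move: lt_a; rewrite lt_rearr//.
move=> /lt_distr_sup[j]; rewrite -lt_rearr// => aj.
by have := lt_le_trans aj (le_a j); rewrite ltxx.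
Qed.

Lemma nondecreasing_rearr_avg t : (0 < t)%R ->
  nondecreasing_seq (fun j => rearr_avg (f_ j) t).
Proof.
move=> t0 i j ij; apply: le_rearr_avg_ae => //.
by apply: filterS ff => x fx xT; exact: (fx xT).1.
Qed.

Lemma cvg_rearr_avg t : (0 < t)%R ->
  rearr_avg (f_ j) t @[j --> \oo] --> rearr_avg f t.
Proof.
move=> t0; apply: cvgeZl => //.
have -> : \int[leb]_(s in `]0%R, t[) rearr f s =
    \int[leb]_(s in `]0%R, t[) limn (fun j => rearr (f_ j) s).
  by apply: eq_integral => s _; apply/esym/cvg_lim => //; exact: cvg_rearr.
apply: cvg_monotone_convergence.
- exact: measurable_completed_itv.
- by move=> j; exact: measurable_rearr.
- by move=> j s _; exact: rearr_ge0.
- by move=> s _; exact: nondecreasing_rearr.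
Qed.

End increasing.

(** For an indicator both bounds result from the minimum formula, whose optimal
    level lies in [0, 1]. *)
Section indicator.
Variables (E : set T) (m : R).
Hypotheses (mE : measurable E) (Em : mu E = m%:E).

Let mE1 : measurable_fun setT (fun x => (\1_E x : R)%:E).
Proof. by apply/measurable_EFinP; exact: measurable_indic. Qed.

Let excess_indic c : (0 <= c <= 1)%R ->
  excess (fun x => (\1_E x)%:E) c = ((1 - c) * m)%:E.
Proof.
move=> /andP[c0 c1]; rewrite EFinM -Em -[X in mu X]setIT -integral_indic//.
rewrite -ge0_integralZl//; last by rewrite lee_fin subr_ge0.
apply: eq_integral => x _; rewrite indicE; case: (x \in E) => /=.
  rewrite normr1 mule1 -EFinB; apply/max_idPl.
  by rewrite lee_fin subr_ge0.
by rewrite normr0 mule0 -EFinB; apply/max_idPr; rewrite lee_fin sub0r oppr_le0.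
Qed.

Lemma rearr_avg_indic_le t : (0 < t)%R ->
  rearr_avg (fun x => (\1_E x)%:E) t <= (Num.max 1 m)%:E * psi t.
Proof.
move=> t0; have := rearr_avg_le mE1 (lexx 0%R) t0.
have := rearr_avg_le mE1 ler01 t0.
rewrite !excess_indic ?ler01 ?lexx// subrr mul0r mule0 add0e.
rewrite subr0 mul1r adde0 /psi -!EFinM => A1 Am.
case: (leP 1 t^-1)%R => _.
  by apply: (le_trans A1); rewrite lee_fin mulr1 le_max lexx.
apply: (le_trans Am); rewrite lee_fin mulrC.
apply: ler_wpM2r; first by rewrite invr_ge0 ltW.
by rewrite le_max lexx orbT.
Qed.

Lemma psi_le_rearr_avg_indic t : m = 1%R -> (0 < t)%R ->
  psi t <= rearr_avg (fun x => (\1_E x)%:E) t.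
Proof.
move=> m1 t0; have [->|[c [c0 fc ->]]] := rearr_avgP mE1 t0; first exact: leey.
have c1 : (c <= 1)%R.
  rewrite -lee_fin -fc; apply: rearr_le => //; rewrite /distr.
  rewrite (_ : [set _ | _] = set0) ?measure0 ?lee_fin ?ltW//.
  apply/seteqP; split => x //=; rewrite indicE lte_fin.
  by case: (x \in E); rewrite ?normr1 ?normr0 ?ltxx// ltr10.
rewrite excess_indic ?c0// m1 mulr1 -EFinM -EFinD /psi lee_fin.
have t'0 : (0 < t^-1)%R by rewrite invr_gt0.
by case: (leP 1 t^-1)%R => ?; nra.
Qed.

End indicator.

End rearrangement.

(** * Boxes and cubes in R^n *)
Section coordinatewise_integration.
Context (R : realType) (I : eqType).
Implicit Types (a b x : I -> R) (s : seq I).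

Local Notation ind a b y := (\1_[set` `]a%R, b%R]] y : R).
Local Notation len a b := (Num.max 0 (b - a))%R.

Let len_ge0 (a b : R) : (0 <= len a b)%R.
Proof. by rewrite le_max lexx. Qed.

Let ind_ge0 (a b y : R) : (0 <= ind a b y)%R.
Proof. by rewrite indicE. Qed.

Let integral_ind (c a b : R) : (0 <= c)%R ->
  \int[@lebesgue_measure R]_y (c * ind a b y)%:E = (c * len a b)%:E.
Proof.
move=> c0; under eq_integral do rewrite EFinM.
rewrite ge0_integralZl//; last first.
  by apply/measurable_EFinP; apply: measurable_indic; exact: measurable_itv.
rewrite integral_indic//.
rewrite setIT EFinM; congr (_ * _); apply: (etrans (lebesgue_measure_itv _)).
rewrite /= lte_fin; case: ltP => ab; rewrite -?EFinB; congr (_%:E).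
  by rewrite max_r// subr_ge0 ltW.
by rewrite max_l// subr_le0.
Qed.

(** If the indicator of a box is at most a weighted sum of indicators of boxes,
    then the same holds for the volumes. Integrating the inequality in one
    coordinate replaces the indicator of a side by its length, and this can be
    repeated coordinate by coordinate with monotone convergence; the weights
    absorb the lengths already produced. For a covering this says that the
    volume of a box is at most its outer measure, with no use of compactness. *)
Lemma prod_len_le_series s a b (W : R) (w : nat -> R) (al be : nat -> I -> R) :
  uniq s -> (0 <= W)%R -> (forall k, 0 <= w k)%R ->
  (forall x, (W * \prod_(i <- s) ind (a i) (b i) (x i))%:E <=
    \sum_(k <oo) (w k * \prod_(i <- s) ind (al k i) (be k i) (x i))%:E) ->
  (W * \prod_(i <- s) len (a i) (b i))%:E <=
    \sum_(k <oo) (w k * \prod_(i <- s) len (al k i) (be k i))%:E.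
Proof.
elim: s W w => [|i s IHs] W w.
  move=> _ _ _ /(_ a); rewrite !big_nil.
  under eq_eseriesr do rewrite big_nil.
  by under [in X in _ -> X]eq_eseriesr do rewrite big_nil.
move=> /andP[si us] W0 w0 H.
rewrite big_cons mulrA; under eq_eseriesr do rewrite big_cons mulrA.
apply: IHs => // [|k|x]; [exact: mulr_ge0|exact: mulr_ge0|].
pose upd (y : R) := fun j => if j == i then y else x j.
have updE (F : I -> R -> R) y :
    (\prod_(j <- s) F j (upd y j) = \prod_(j <- s) F j (x j))%R.
  rewrite big_seq [RHS]big_seq; apply: eq_bigr => j js; rewrite /upd.
  by case: eqP => // ji; rewrite -ji js in si.
set P := (\prod_(j <- s) _)%R.
have P0 : (0 <= P)%R by apply: prodr_ge0 => j _; exact: ind_ge0.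
pose Q k := (\prod_(j <- s) ind (al k j) (be k j) (x j))%R.
have Q0 k : (0 <= Q k)%R by apply: prodr_ge0 => j _; exact: ind_ge0.
have -> : (W * len (a i) (b i) * P)%:E =
    \int[@lebesgue_measure R]_y (W * P * ind (a i) (b i) y)%:E.
  by rewrite integral_ind ?mulr_ge0// mulrAC.
have -> : \sum_(k <oo) (w k * len (al k i) (be k i) * Q k)%:E =
    \sum_(k <oo) \int[@lebesgue_measure R]_y (w k * Q k * ind (al k i) (be k i) y)%:E.
  by apply: eq_eseriesr => k _; rewrite integral_ind ?mulr_ge0// mulrAC.
have mind c al' be' :
    measurable_fun setT (fun y : measurableTypeR R => (c * ind al' be' y)%:E).
  by apply/measurable_EFinP; exact: measurable_funM.
rewrite -integral_nneseries//; last first.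
  by move=> k y _; rewrite lee_fin !mulr_ge0// ind_ge0.
apply: ge0_le_integral => //.
- by move=> y _; rewrite lee_fin !mulr_ge0// ind_ge0.
- apply: ge0_emeasurable_sum => // k y _ _.
  by rewrite lee_fin !mulr_ge0// ind_ge0.
move=> y _; have := H (upd y); rewrite big_cons (updE (fun j => \1_[set` `]a j, b j]])).
rewrite {1}/upd eqxx mulrCA mulrC -/P -/(ind _ _ _).
under eq_eseriesr do
  rewrite big_cons (updE (fun j => \1_[set` `]al _ j, be _ j]])) {1}/upd eqxx mulrCA mulrC.
by [].
Qed.

End coordinatewise_integration.

Section lebesgue_measure_Rn.
Context (R : realType) (n : nat).
Implicit Types (a b x : 'rV[R]_n).
Local Notation mu := (@lebesgue_Rn R n).

Let upd a (i : 'I_n) (v : R) : 'rV[R]_n :=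
  \row_j (if j == i then v else a ord0 j).

Let box_volume_cut a b (i : 'I_n) (v : R) :
  box_volume a (upd b i (Num.min (b ord0 i) v)) +
  box_volume (upd a i (Num.max (a ord0 i) v)) b = box_volume a b.
Proof.
rewrite /box_volume -EFinD; congr (_%:E).
rewrite (bigD1 i)//= [X in (_ + X)%R](bigD1 i)//= [RHS](bigD1 i)//=.
rewrite !mxE eqxx.
set p := (\prod_(_ < _ | _) _)%R; set q := (\prod_(_ < _ | _) _)%R.
set r := (\prod_(_ < _ | _) _)%R.
have -> : p = r by apply: eq_bigr => j /negbTE ji; rewrite mxE ji.
have -> : q = r by apply: eq_bigr => j /negbTE ji; rewrite mxE ji.
rewrite -mulrDl; congr (_ * _)%R.
move: (a ord0 i) (b ord0 i) => ai bi.
by case: (leP bi v)%R => ?; case: (leP ai v)%R => ?; do ?case: leP => ?; lra.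
Qed.

(** A hyperplane parallel to the axes cuts each box of a cover into two boxes
    whose volumes add up. *)
Lemma measurable_halfspace (i : 'I_n) (v : R) :
  measurable ([set x : 'rV[R]_n | (x ord0 i <= v)%R] : set (Rn R n)).
Proof.
apply: (@le_caratheodory_measurable R _ (@lebesgue_outer R n)) => X.
apply: le_ereal_inf_tmp => _ [F XF <-].
have -> : \esum_(k in F.1) box_volume (F.2 k).1 (F.2 k).2 =
  \esum_(k in F.1) box_volume (F.2 k).1 (upd (F.2 k).2 i (Num.min ((F.2 k).2 ord0 i) v)) +
  \esum_(k in F.1) box_volume (upd (F.2 k).1 i (Num.max ((F.2 k).1 ord0 i) v)) (F.2 k).2.
  rewrite -esumD; try by move=> k _; exact: box_volume_ge0.
  by apply: eq_esum => k _; rewrite box_volume_cut.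
apply: leeD; apply: ereal_inf_lbound.
- exists (F.1, fun k => ((F.2 k).1, upd (F.2 k).2 i (Num.min ((F.2 k).2 ord0 i) v))) => //.
  move=> x [/XF[k Fk xk] /= xv]; exists k => //= j; rewrite mxE.
  have := xk j; case: eqP => [->|//] /andP[-> xb].
  by rewrite le_min xb.
- exists (F.1, fun k => (upd (F.2 k).1 i (Num.max ((F.2 k).1 ord0 i) v), (F.2 k).2)) => //.
  move=> x [/XF[k Fk xk] /= xv]; exists k => //= j; rewrite mxE.
  have := xk j; case: eqP => [->|//] /andP[ax ->].
  by rewrite gt_max ax andbT/= ltNge; apply/negP.
Qed.

Lemma measurable_coord (i : 'I_n) :
  measurable_fun setT ((fun x => x ord0 i) : Rn R n -> measurableTypeR R).
Proof.
apply: (measurability (@RGenOInfty.G R)).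
  exact: RGenOInfty.measurableE.
move=> /= _ [_ [v ->] <-]; rewrite setTI.
rewrite (_ : _ @^-1` _ = ~` [set x : 'rV[R]_n | (x ord0 i <= v)%R]).
  by apply: measurableC; exact: measurable_halfspace.
by apply/seteqP; split => x /=; rewrite in_itv/= andbT ltNge => /negP.
Qed.

Lemma measurable_cube a (l : R) : measurable (cube a l : set (Rn R n)).
Proof.
have -> : cube a l = \bigcap_(i in setT) (fun x : Rn R n => x ord0 i) @^-1`
    [set` `[(a ord0 i), (a ord0 i + l)%R]].
  apply/seteqP; split => x /= xa i; last by have := xa i Logic.I; rewrite /= in_itv.
  by move=> _; rewrite /= in_itv; exact: xa.
apply: fin_bigcap_measurable => // i _; rewrite -[X in measurable X]setTI.
by apply: measurable_coord => //; exact: measurable_itv.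
Qed.

Lemma box_volume_le_outer a b : box_volume a b <= lebesgue_outer (box a b).
Proof.
apply: le_ereal_inf_tmp => _ [F abF <-].
pose w k : R := (k \in F.1)%:R.
have -> : \esum_(k in F.1) box_volume (F.2 k).1 (F.2 k).2 =
    \sum_(k <oo) (w k * \prod_(i <- index_enum 'I_n)
      Num.max 0 ((F.2 k).2 ord0 i - (F.2 k).1 ord0 i))%:E.
  rewrite esum_mkcond -nneseries_esumT; last first.
    by move=> k; case: ifP => // _; exact: box_volume_ge0.
  apply: eq_eseriesr => k _; rewrite /w; case: (k \in F.1).
    by rewrite mul1r.
  by rewrite mul0r.
rewrite /box_volume -[X in X%:E]mul1r.
apply: (prod_len_le_series (w := w)) => //.
  exact: index_enum_uniq.
move=> x; rewrite mul1r.
have term_ge0 k : 0 <= (w k * \prod_(i <- index_enum 'I_n)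
    \1_[set` `](F.2 k).1 ord0 i, (F.2 k).2 ord0 i]] (x i))%:E :> \bar R.
  by rewrite lee_fin mulr_ge0 ?ler0n// prodr_ge0// => i _; rewrite indicE.
have [xab|xab] := pselect (forall i, x i \in `](a ord0 i), (b ord0 i)]); last first.
  move/existsNP : xab => [i /negP xi]; rewrite (bigD1 i)//= indicE memNset//=.
    rewrite mul0r; apply: nneseries_ge0 => k _ _; exact: term_ge0.
  exact/negP.
have /abF[k Fk xk] : box a b (\row_i x i).
  by move=> i; rewrite mxE; have := xab i; rewrite in_itv.
apply: le_trans (nneseries_lim_ge k.+1 _) => //.
rewrite big_mkord big_ord_recr/= -[leLHS]add0e; apply: leeD.
  by apply: sume_ge0 => j _; exact: term_ge0.
rewrite /w mem_set// mul1r lee_fin.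
have xk1 i : \1_[set` `](F.2 k).1 ord0 i, (F.2 k).2 ord0 i]] (x i) = 1%R :> R.
  by rewrite indicE mem_set//=; have := xk i; rewrite mxE in_itv.
have x1 i : \1_[set` `](a ord0 i), (b ord0 i)]] (x i) = 1%R :> R.
  by rewrite indicE mem_set//=; exact: xab.
by rewrite (eq_bigr (fun=> 1%R))// [leRHS](eq_bigr (fun=> 1%R)).
Qed.

Lemma expr_enlarge (l v : R) : (0 <= l)%R -> (l ^+ n < v)%R ->
  exists2 e, (0 < e)%R & ((l + e) ^+ n < v)%R.
Proof.
move=> l0 lv.
have : ((l + k.+1%:R^-1) ^+ n @[k --> \oo] --> (l + 0) ^+ n)%R.
  apply: (@cvg_comp _ _ _ _ (fun x : R => x ^+ n)%R); last exact: exprn_continuous.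
  by apply: cvgD; [exact: cvg_cst|exact: cvg_harmonic].
rewrite addr0 => /cvgr_lt/(_ _ lv)[k _ /(_ k (leqnn k)) kv].
by exists k.+1%:R^-1%R; rewrite ?invr_gt0.
Qed.

(** The outer measure is at most the volume of a slightly larger half-open box
    containing the closed cube, and at least that of the half-open box inside
    it. *)
Lemma lebesgue_cube a (l : R) : (0 <= l)%R -> mu (cube a l) = (l ^+ n)%:E.
Proof.
move=> l0; apply/eqP; rewrite eq_le; apply/andP; split.
  apply/lee_addgt0Pr => v v0.
  have [e e0 ev] := expr_enlarge l0 (ltr_pwDr v0 (lexx (l ^+ n)%R)).
  rewrite -EFinD (le_trans _ (_ : ((l + e) ^+ n)%:E <= _))//; last first.
    by rewrite lee_fin ltW.
  apply: ereal_inf_lbound.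
  exists ([set 0%N], fun=> (a - const_mx e, a + const_mx l)%R) => /=.
    move=> x xa; exists 0%N => // i; rewrite !mxE.
    by have /andP[ax xl] := xa i; rewrite xl andbT; lra.
  rewrite esum_set1 ?box_volume_ge0// /box_volume (eq_bigr (fun=> (l + e)%R)).
    by rewrite prodr_const card_ord.
  by move=> i _; rewrite !mxE max_r; lra.
apply: (@le_trans _ _ (mu (box a (a + const_mx l)%R))); last first.
  apply: le_outer_measure => x xa i; have := xa i; rewrite !mxE => /andP[ax ->].
  by rewrite ltW.
apply: le_trans (box_volume_le_outer _ _).
rewrite /box_volume (eq_bigr (fun=> l)) ?prodr_const ?card_ord// => i _.
by rewrite !mxE addrAC subrr add0r max_r.
Qed.

End lebesgue_measure_Rn.

Lemma lebesgue_Rn_sigma_finite (R : realType) (n : nat) :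
  sigma_finite setT (@lebesgue_Rn R n).
Proof.
exists (fun k => cube (const_mx (- k%:R)%R) (k%:R *+ 2)%R).
  apply/seteqP; split => // x _.
  pose k := (Num.truncn (\sum_i `|x ord0 i|)%R).+1.
  exists k => // i; rewrite !mxE.
  have : (`|x ord0 i| <= k%:R)%R.
    apply: le_trans (ltW (truncnS_gt _)).
    by rewrite (bigD1 i)//= lerDl sumr_ge0.
  by rewrite ler_norml => /andP[-> xk] /=; lra.
move=> k; split; first exact: measurable_cube.
by rewrite lebesgue_cube ?ltry// mulrn_wge0.
Qed.

HB.instance Definition _ (R : realType) (n : nat) :=
  Measure_isSigmaFinite.Build _ _ _ (@lebesgue_Rn R n)
    (@lebesgue_Rn_sigma_finite R n).

Section covering.
Context (R : realType) (n : nat).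
Local Notation mu := (@lebesgue_Rn R n).
Local Notation cubes := ('rV[R]_n * R)%type.

Definition cube_union (s : seq cubes) : set (Rn R n) :=
  \bigcup_(p in [set` s]) cube p.1 p.2.

Lemma measurable_cube_union s : measurable (cube_union s).
Proof.
by apply: fin_bigcup_measurable => // p _; exact: measurable_cube.
Qed.

Let largest_cube (s : seq cubes) : s != [::] ->
  exists2 p, p \in s & forall q, q \in s -> (q.2 <= p.2)%R.
Proof.
elim: s => // p [|q s] IHs _; first by exists p => [|q]; rewrite inE// => /eqP->.
have [//|r rs rmax] := IHs; have [pr|rp] := leP p.2 r.2.
  exists r => [|u]; first by rewrite in_cons rs orbT.
  by rewrite in_cons => /predU1P[->//|]; exact: rmax.
exists p => [|u]; rewrite ?mem_head// in_cons => /predU1P[->//|/rmax].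
by move=> /le_trans; apply; exact: ltW.
Qed.

Let cube_meet_sub (p q : cubes) : (q.2 <= p.2)%R ->
  cube q.1 q.2 `&` cube p.1 p.2 !=set0 ->
  cube q.1 q.2 `<=` cube (p.1 - const_mx p.2)%R (3 * p.2)%R.
Proof.
move=> qp [y [qy py]] x qx i; rewrite !mxE.
have /andP[? ?] := qy i; have /andP[? ?] := py i; have /andP[? ?] := qx i.
by apply/andP; split; lra.
Qed.

(** Vitali's covering argument, run directly on the quantities to be compared:
    the largest cube [p] is kept, every cube meeting it lies in the cube with the
    same centre and three times the edge, and the remaining cubes are disjoint
    from [p], so that the integrals of [g] over [p] and over their union add
    up. *)
Lemma cube_covering (g : Rn R n -> \bar R) (lam : R) (s : seq cubes) :
  measurable_fun setT g -> (forall x, 0 <= g x) -> (0 <= lam)%R ->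
  (forall p, p \in s -> (0 < p.2)%R /\
     (lam * p.2 ^+ n)%:E <= \int[mu]_(x in cube p.1 p.2) g x) ->
  lam%:E * mu (cube_union s) <=
    (3 ^+ n)%:E * \int[mu]_(x in cube_union s) g x.
Proof.
move=> mg g0 lam0; have [m] := ubnP (size s); elim: m s => // m IHm s sm Hs.
have [->|s0] := eqVneq s [::].
  rewrite /cube_union (_ : [set` [::]] = set0); last by apply/seteqP; split.
  by rewrite bigcup_set0 measure0 integral_set0 !mule0.
have [p ps pmax] := largest_cube s0.
pose s' := [seq q <- s | ~~ `[< cube q.1 q.2 `&` cube p.1 p.2 !=set0 >]].
have [p0 Hp] := Hs p ps.
have s's : (size s' < size s)%N.
  rewrite size_filter -(count_predC (fun q : cubes =>
    `[< cube q.1 q.2 `&` cube p.1 p.2 !=set0 >]) s) -[ltnLHS]add0n ltn_add2r.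
  rewrite -has_count; apply/hasP; exists p => //; apply/asboolP; exists p.1.
  by split => i; rewrite lexx lerDl ltW.
have Hs' : forall q, q \in s' -> (0 < q.2)%R /\
     (lam * q.2 ^+ n)%:E <= \int[mu]_(x in cube q.1 q.2) g x.
  by move=> q; rewrite mem_filter => /andP[_ /Hs].
have {IHm Hs'} IH := IHm s' (leq_trans s's sm) Hs'.
have mQ : measurable (cube p.1 p.2 : set (Rn R n)) by exact: measurable_cube.
have mU := measurable_cube_union.
pose Q3 : set (Rn R n) := cube (p.1 - const_mx p.2)%R (3 * p.2)%R.
have mQ3 : measurable Q3 by exact: measurable_cube.
have U3 : mu (cube_union s) <= mu Q3 + mu (cube_union s').
  apply: le_trans (measureU2 _ mQ3 (mU s')).
  apply: le_measure; rewrite ?inE//; first exact: measurableU.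
  move=> x [q qs qx].
  have [qp|/asboolPn qp] :=
    pselect (cube q.1 q.2 `&` cube p.1 p.2 !=set0).
    by left; exact: (cube_meet_sub (pmax q qs) qp).
  by right; exists q => //=; rewrite mem_filter qp.
have Q3E : mu Q3 = (3 ^+ n * p.2 ^+ n)%:E.
  by rewrite lebesgue_cube ?exprMn// mulr_ge0// ltW.
apply: (@le_trans _ _ (lam%:E * (mu Q3 + mu (cube_union s')))).
  by apply: lee_wpmul2l => //; rewrite lee_fin.
rewrite (@ge0_muleDr _ _ (mu Q3)) ?measure_ge0//.
apply: (@le_trans _ _ ((3 ^+ n)%:E * \int[mu]_(x in cube p.1 p.2) g x +
    (3 ^+ n)%:E * \int[mu]_(x in cube_union s') g x)).
  apply: leeD => //; rewrite Q3E -EFinM mulrCA EFinM.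
  by apply: lee_wpmul2l => //; rewrite lee_fin exprn_ge0.
rewrite -ge0_muleDr ?integral_ge0// -ge0_integral_setU//; last 2 first.
- exact: measurable_funTS.
- rewrite disj_set2E; apply/eqP/seteqP; split => // x [px [q]] /=.
  by rewrite mem_filter => /andP[/asboolPn qp _] qx; apply: qp; exists x.
apply: lee_wpmul2l; first by rewrite lee_fin exprn_ge0.
apply: ge0_subset_integral => //.
- exact: measurableU.
- exact: measurable_funTS.
- move=> x [px|[q /=]]; first by exists p.
  by rewrite mem_filter => /andP[_ qs] qx; exists q.
Qed.

End covering.

(** * The maximal function *)
Section maximal_function.
Context (R : realType) (n : nat).
Local Notation mu := (@lebesgue_Rn R n).
Local Notation cubes := ('rV[R]_n * R)%type.
Implicit Types (f : Rn R n -> \bar R) (p q : cubes).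

Definition cube_avg f p : \bar R :=
  ((p.2 ^+ n)^-1)%:E * \int[mu]_(y in cube p.1 p.2) `|f y|.

Lemma HL_maxE f x : HL_max f x =
  ereal_sup [set cube_avg f p | p in
    [set p | (0 < p.2)%R /\ cube p.1 p.2 x]].
Proof.
congr ereal_sup; apply/seteqP; split => y /=.
  move=> [_ [a [l [l0 -> ax]]] <-]; exists (a, l) => //.
  by rewrite /cube_avg/= lebesgue_cube ?ltW// inver gt_eqF// exprn_gt0.
move=> [[a l] /= [l0 ax] <-]; exists (cube a l); first by exists a, l.
by rewrite /cube_avg/= lebesgue_cube ?ltW// inver gt_eqF// exprn_gt0.
Qed.

Lemma cube_avg_ge0 f p : (0 <= p.2)%R -> 0 <= cube_avg f p.
Proof.
by move=> p0; rewrite mule_ge0 ?integral_ge0// lee_fin invr_ge0 exprn_ge0.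
Qed.

Lemma le_HL_max f p x : (0 < p.2)%R -> cube p.1 p.2 x ->
  cube_avg f p <= HL_max f x.
Proof. by move=> p0 px; rewrite HL_maxE; apply: ereal_sup_ubound; exists p. Qed.

Lemma HL_max_ge0 f x : 0 <= HL_max f x.
Proof.
apply: le_trans (@le_HL_max f (x, 1%R) x _ _) => //; first exact: cube_avg_ge0.
by move=> i /=; rewrite lexx lerDl ler01.
Qed.

Definition rat_cube (u : 'rV[rat]_n * rat) : cubes :=
  (map_mx (@ratr R) u.1, ratr u.2).

(** A cube may be enlarged slightly without losing a strict lower bound on the
    average, since the integral can only grow while the volume varies
    continuously. Hence countably many cubes determine the superlevel sets of the
    maximal function, which yields its measurability and reduces covering
    arguments to finitely many cubes. *)
Lemma cube_avg_enlarge f p (z : R) : measurable_fun setT f ->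
  (0 < p.2)%R -> z%:E < cube_avg f p ->
  exists u, [/\ (0 < (rat_cube u).2)%R,
    cube p.1 p.2 `<=` cube (rat_cube u).1 (rat_cube u).2 &
    z%:E < cube_avg f (rat_cube u)].
Proof.
move=> mf p0 zp; pose I := \int[mu]_(y in cube p.1 p.2) `|f y|.
have I0 : 0 <= I by exact: integral_ge0.
have [e e0 He] : exists2 e : R, (0 < e)%R & forall L, (p.2 <= L <= p.2 + e)%R ->
    z%:E < ((L ^+ n)^-1)%:E * I.
  have L0 (L : R) : (p.2 <= L)%R -> (0 < L ^+ n)%R.
    by move=> pL; rewrite exprn_gt0// (lt_le_trans p0).
  move: zp; rewrite /cube_avg -/I; case: I I0 => [v| |//]; last first.
    move=> _ _; exists 1%R => // L /andP[/L0 Ln _].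
    by rewrite gt0_muley ?ltry// lte_fin invr_gt0.
  rewrite lee_fin -EFinM lte_fin => v0 zp.
  have [z0|z0] := leP z 0%R.
    exists 1%R => // L /andP[/L0 Ln _]; rewrite -EFinM lte_fin.
    move: z0 zp; rewrite le_eqVlt => /predU1P[->|z0].
      by rewrite pmulr_rgt0 ?invr_gt0 ?exprn_gt0// pmulr_rgt0 ?invr_gt0.
    by move=> _; rewrite (lt_le_trans z0)// mulr_ge0// invr_ge0 ltW.
  have [|e e0 ev] := @expr_enlarge R n p.2 (v / z) (ltW p0).
    by rewrite ltr_pdivlMr// mulrC -ltr_pdivlMr ?exprn_gt0// mulrC.
  exists e => // L /andP[pL Le]; rewrite -EFinM lte_fin mulrC.
  rewrite ltr_pdivlMr ?L0// mulrC -ltr_pdivlMr//; apply: le_lt_trans ev.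
  have pL0 := lt_le_trans p0 pL.
  by apply: lerXn2r => //; rewrite nnegrE; lra.
pose near_corner (i : 'I_n) (q : rat) : Prop :=
  (p.1 ord0 i - e / 2 < ratr q < p.1 ord0 i)%R.
have [c Hc] : {c & forall i, near_corner i (c i)}.
  apply: (@choice _ _ near_corner) => i.
  have [|q qi] := @rat_in_itvoo R (p.1 ord0 i - e / 2)%R (p.1 ord0 i); first lra.
  by exists q; move: qi; rewrite in_itv.
have [|r] := @rat_in_itvoo R (p.2 + e / 2)%R (p.2 + e)%R; first by lra.
rewrite in_itv/= => /andP[r1 r2].
have sub : cube p.1 p.2 `<=` cube (map_mx (@ratr R) (\row_i c i)) (ratr r).
  move=> x px i; rewrite !mxE; have /andP[? ?] := Hc i.
  by have /andP[? ?] := px i; apply/andP; split; lra.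
exists (\row_i c i, r); rewrite /rat_cube/=; split => //; first lra.
apply: (lt_le_trans (He (ratr r) _)); first by apply/andP; split; lra.
apply: lee_wpmul2l; first by rewrite lee_fin invr_ge0 exprn_ge0//=; lra.
apply: ge0_subset_integral; [exact: measurable_cube|exact: measurable_cube| | |
  exact: sub].
  by apply: measurable_funTS; exact: measurableT_comp.
by move=> y _; exact: abse_ge0.
Qed.

(** Indexed by naturals, so that the cubes with indices below [m] are finitely
    many and their unions increase to the whole superlevel set. *)
Definition heavy_cube f (z : R) (k : nat) : option cubes :=
  if unpickle k is Some u then
    if `[< (0 < (rat_cube u).2)%R /\ z%:E < cube_avg f (rat_cube u) >]
    then Some (rat_cube u) else None
  else None.

Definition heavy_cubes f (z : R) (m : nat) : seq cubes :=
  pmap (heavy_cube f z) (iota 0 m).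

Lemma heavy_cubesP f (z : R) m p : p \in heavy_cubes f z m ->
  (0 < p.2)%R /\ z%:E < cube_avg f p.
Proof.
rewrite mem_pmap => /mapP[k _]; rewrite /heavy_cube.
by case: unpickle => // u; case: asboolP => // ? [->].
Qed.

Lemma HL_max_superlevel f (z : R) : measurable_fun setT f ->
  [set x | z%:E < HL_max f x] = \bigcup_m cube_union (heavy_cubes f z m).
Proof.
move=> mf; apply/seteqP; split => x /=.
  rewrite HL_maxE => /ereal_sup_gt[_ [p [p0 px] <-] zp].
  have [u [u0 pu zu]] := cube_avg_enlarge mf p0 zp.
  exists (pickle u).+1 => //; exists (rat_cube u); last exact: pu.
  rewrite /= mem_pmap; apply/mapP; exists (pickle u).
    by rewrite mem_iota add0n ltnS leqnn.
  by rewrite /heavy_cube pickleK; case: asboolP => // -[].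
move=> [m _ [p /= /heavy_cubesP[p0 zp] px]].
by apply: (lt_le_trans zp); exact: le_HL_max.
Qed.

Lemma measurable_HL_max f : measurable_fun setT f ->
  measurable_fun setT (HL_max f : Rn R n -> \bar R).
Proof.
move=> mf; apply: (measurability (@ErealGenOInfty.G R)).
  exact: ErealGenOInfty.measurableE.
move=> /= _ [_ [r ->] <-]; rewrite setTI.
rewrite (_ : _ @^-1` _ = [set x | r%:E < HL_max f x]).
  rewrite HL_max_superlevel//; apply: bigcupT_measurable => m.
  exact: measurable_cube_union.
by apply/seteqP; split => x /=; rewrite in_itv/= andbT.
Qed.

(** The weak type estimate for the part of [f] above height [c]: over a cube
    where the average of [|f|] exceeds [z], the average of [(|f| - c)_+] exceeds
    [z - c]. *)
Lemma HL_max_weak f (c z : R) : measurable_fun setT f -> (0 <= c < z)%R ->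
  (z - c)%:E * mu [set x | z%:E < HL_max f x] <= (3 ^+ n)%:E * excess mu f c.
Proof.
move=> mf /andP[c0 cz]; have zc : (0 < z - c)%R by lra.
rewrite muleC -lee_pdivlMr// HL_max_superlevel//.
apply: measure_bigcup_le => [m|i j ij|m].
- exact: measurable_cube_union.
- apply/subsetPset => x [p /= ps px]; exists p => //=; move: ps.
  rewrite !mem_pmap => /mapP[k ki ->]; apply/mapP; exists k => //.
  by move: ki; rewrite !mem_iota !add0n/= => /leq_trans; apply.
rewrite lee_pdivlMr// muleC.
pose g x := maxe (`|f x| - c%:E) 0.
have mg : measurable_fun setT g by exact: measurable_excess_fun.
have g0 x : 0 <= g x by rewrite /g le_max lexx orbT.
apply: (@le_trans _ _ ((3 ^+ n)%:E *
    \int[mu]_(x in cube_union (heavy_cubes f z m)) g x)); last first.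
  apply: lee_wpmul2l; first by rewrite lee_fin exprn_ge0.
  by apply: ge0_subset_integral => //; exact: measurable_cube_union.
apply: cube_covering => //; first exact: ltW.
move=> p /heavy_cubesP[p0 zp]; split => //.
have pn0 : (0 < p.2 ^+ n)%R by rewrite exprn_gt0.
have mp : measurable (cube p.1 p.2 : set (Rn R n)) by exact: measurable_cube.
have : (z * p.2 ^+ n)%:E <= \int[mu]_(x in cube p.1 p.2) g x + (c * p.2 ^+ n)%:E.
  have -> : (c * p.2 ^+ n)%:E = \int[mu]_(x in cube p.1 p.2) c%:E.
    rewrite EFinM -(lebesgue_cube p.1 (ltW p0)).
    by apply/esym; exact: integral_cst.
  rewrite -ge0_integralD//; last exact: measurable_funTS.
  move: zp; rewrite /cube_avg muleC lte_pdivlMr// -EFinM => /ltW zp.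
  apply: (le_trans zp); apply: ge0_le_integral.
  - exact: mp.
  - by move=> x _; exact: abse_ge0.
  - by apply: measurable_funTS; exact: measurableT_comp.
  - by apply: emeasurable_funD => //; exact: measurable_funTS.
  - by move=> x _; rewrite -leeBlDr// le_max lexx.
by rewrite -leeBlDr// -EFinB mulrBl.
Qed.

(** Herz's upper estimate. With [c] the value at [t] of the rearrangement of
    [f], the weak type bound shows that the maximal function exceeds
    [c + 3 ^ n * excess f c / t] on a set of measure at most [t], and this height
    is at most [3 ^ n] times the average [excess f c / t + c]. *)
Lemma rearr_HL_max_le f (t : R) : measurable_fun setT f -> (0 < t)%R ->
  rearr mu setT (HL_max f) t <= (3 ^+ n)%:E * rearr_avg mu setT f t.
Proof.
move=> mf t0; have n3 : (1 <= 3 ^+ n :> R)%R by rewrite exprn_ege1// ler1n.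
have n30 : (0 < 3 ^+ n :> R)%R by exact: lt_le_trans n3.
have [->|[c [c0 _ ->]]] := rearr_avgP mu mf t0.
  by rewrite gt0_muley ?leey.
case E : (excess mu f c) (excess_ge0 mu f c) => [v| |//]; last first.
  by rewrite gt0_muley ?lte_fin ?invr_gt0// addye// gt0_muley ?leey.
rewrite lee_fin -[_ * v%:E]EFinM -EFinD -EFinM => v0; apply/lee_addgt0Pr => e e0.
(* The term [e] keeps [z - c] positive when the excess [v] vanishes. *)
pose z := (c + 3 ^+ n * v / t + e)%R.
have w0 : (0 <= 3 ^+ n * v / t)%R by rewrite divr_ge0 ?mulr_ge0// ltW.
apply: (@le_trans _ _ z%:E).
  apply: rearr_le; [exact: measurable_HL_max|rewrite /z; lra|].
  have cz : (0 <= c < z)%R by rewrite c0 /z; lra.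
  have zc : (0 < z - c)%R by rewrite /z; lra.
  have := HL_max_weak mf cz; rewrite E -EFinM.
  rewrite muleC -lee_pdivlMr// /distr.
  rewrite (_ : [set x | z%:E < `|HL_max f x|] = [set x | z%:E < HL_max f x]);
    last by apply/seteqP; split => x /=; rewrite gee0_abs// HL_max_ge0.
  move=> /le_trans; apply; rewrite -EFinM lee_fin ler_pdivrMr//.
  by rewrite [leRHS]mulrC -ler_pdivrMr// /z; lra.
rewrite -EFinD lee_fin /z lerD2r mulrDr [X in (_ <= X)%R]addrC lerD//.
  by rewrite ler_peMl.
by rewrite mulrA mulrAC.
Qed.

End maximal_function.

(** * Radial rearrangements on R^n *)
Section radial.
Context (R : realType) (n : nat).
Hypothesis n_gt0 : (0 < n)%N.
Local Notation mu := (@lebesgue_Rn R n).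
Implicit Types (f : Rn R n -> \bar R) (x : Rn R n) (h : R -> \bar R).

Definition sup_norm (x : 'rV[R]_n) : R := (\big[Num.max/0]_(i < n) `|x ord0 i|)%R.

(** The volume of the smallest cube centred at the origin that contains [x].
    Since this cube has measure [radial x], composition with [radial] turns a
    nonincreasing function on the half-line into an equimeasurable function on
    R^n; the sup norm is used because its balls are
    the cubes of the maximal operator. *)
Definition radial (x : Rn R n) : R := ((2 * sup_norm x) ^+ n)%R.

Definition centered_cube (l : R) : set 'rV[R]_n := cube (const_mx (- (l / 2))%R) l.

Lemma sup_norm_ge0 x : (0 <= sup_norm x)%R.
Proof. exact: bigmax_ge_id. Qed.

Lemma radial_ge0 x : (0 <= radial x)%R.
Proof. by rewrite exprn_ge0// mulr_ge0// sup_norm_ge0. Qed.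

Lemma radial_le x (l : R) : (0 <= l)%R ->
  (radial x <= l ^+ n)%R <-> centered_cube l x.
Proof.
move=> l0; rewrite /radial ler_pXn2r ?nnegrE//; last first.
  by rewrite mulr_ge0// sup_norm_ge0.
have -> : (2 * sup_norm x <= l)%R = (sup_norm x <= l / 2)%R.
  by rewrite ler_pdivlMr// mulrC.
split.
  move=> /bigmax_leP[_ xl] i; rewrite !mxE; have := xl i isT.
  by rewrite ler_norml => /andP[? ?]; apply/andP; split; lra.
move=> xl; apply/bigmax_leP; split; first by rewrite divr_ge0.
move=> i _; have := xl i; rewrite !mxE ler_norml => /andP[? ?].
by apply/andP; split; lra.
Qed.

Lemma exists_nthroot (s : R) : (0 <= s)%R -> exists2 l, (0 <= l)%R & (l ^+ n = s)%R.
Proof.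
move=> s0; exists (s `^ n%:R^-1)%R; first exact: powR_ge0.
rewrite -powR_mulrn ?powR_ge0// -powRrM mulVf ?powRr1//.
by rewrite pnatr_eq0 -lt0n.
Qed.

Lemma radial_ballE (s : R) : (0 <= s)%R -> exists l, [/\ (0 <= l)%R, (l ^+ n = s)%R &
  [set x | (radial x <= s)%R] = centered_cube l].
Proof.
move=> /exists_nthroot[l l0 ls]; exists l; split => //.
by apply/seteqP; split => x /=; rewrite -ls; move/radial_le; apply.
Qed.

Lemma measurable_radial_ball (s : R) : measurable [set x | (radial x <= s)%R].
Proof.
have [s0|s0] := ltP s 0%R.
  rewrite (_ : [set _ | _] = set0)//; apply/seteqP; split => // x /= xs.
  by have := radial_ge0 x; rewrite leNgt (le_lt_trans xs s0).
by have [l [_ _ ->]] := radial_ballE s0; exact: measurable_cube.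
Qed.

Lemma lebesgue_radial_ball (s : R) : (0 <= s)%R ->
  mu [set x | (radial x <= s)%R] = s%:E.
Proof.
by move=> s0; have [l [l0 <- ->]] := radial_ballE s0; exact: lebesgue_cube.
Qed.

Lemma measurable_radial : measurable_fun setT (radial : Rn R n -> measurableTypeR R).
Proof.
apply: (measurability (@RGenOInfty.G R)).
  exact: RGenOInfty.measurableE.
move=> /= _ [_ [v ->] <-]; rewrite setTI.
rewrite (_ : _ @^-1` _ = ~` [set x | (radial x <= v)%R]).
  by apply: measurableC; exact: measurable_radial_ball.
by apply/seteqP; split => x /=; rewrite in_itv/= andbT ltNge => /negP.
Qed.

Section profile.
Variable h : R -> \bar R.
Hypothesis h_ge0 : forall s, (0 <= s)%R -> 0 <= h s.
Hypothesis h_noninc : forall s t, (0 < s)%R -> (s <= t)%R -> h t <= h s.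

Lemma measurable_radial_comp : measurable_fun setT (h \o radial : Rn R n -> \bar R).
Proof.
apply: (measurable_comp (F := [set` `[0%R, +oo[] : set (measurableTypeR R)) _ _ _
  measurable_radial).
- exact: measurable_itv.
- by move=> _ [x _ <-]; rewrite /= in_itv/= andbT radial_ge0.
apply/emeasurable_fun_itv_obnd_cbndP; apply: nonincreasing_measurable_itv.
by move=> s t; rewrite !in_itv/= !andbT => s0 _; exact: h_noninc.
Qed.

Hypothesis h_lsc : forall l t, (0 <= l)%R -> (0 < t)%R -> l%:E < h t ->
  exists2 s, (t < s)%R & l%:E < h s.

(** A right-continuous nonincreasing [h] is recovered from [h \o radial], whose
    superlevel sets are centred cubes up to null sets. The origin, where [h] is
    evaluated at [0], has measure zero. *)
Lemma rearr_radial t : (0 < t)%R -> rearr mu setT (h \o radial) t = h t.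
Proof.
move=> t0; have mh := measurable_radial_comp.
have habs x : `|(h \o radial) x| = h (radial x).
  by rewrite /= gee0_abs// h_ge0// radial_ge0.
apply/eqP; rewrite eq_le; apply/andP; split.
  case E : (h t) (h_ge0 (ltW t0)) => [c| |//] c0; last exact: leey.
  apply: rearr_le => //; rewrite -(lebesgue_radial_ball (ltW t0)).
  apply: le_measure; rewrite ?inE; first exact: measurable_superlevel.
    exact: measurable_radial_ball.
  move=> x; rewrite /= habs; apply: contraTT; rewrite -!ltNge => /ltW xt.
  by rewrite -leNgt -E; exact: h_noninc.
rewrite leNgt; apply/negP => lth.
case E : (rearr mu setT (h \o radial) t) (rearr_ge0 mu (h \o radial) t) lth =>
  [a| |//] a0; last by rewrite ltNge leey.
move=> /(h_lsc a0 t0)[s ts as_].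
have s0 : (0 <= s)%R by lra.
suff : s%:E <= t%:E by rewrite lee_fin leNgt ts.
apply: (@le_trans _ _ (distr mu (h \o radial) a)); last first.
  by rewrite leNgt -lt_rearr// E ltxx.
rewrite -(lebesgue_radial_ball s0).
apply: (@measure_negligibleU_le _ _ _ mu _ _ [set x | (radial x <= 0)%R]).
- exact: measurable_radial_ball.
- exact: measurable_superlevel.
- exact: measurable_radial_ball.
- exact: lebesgue_radial_ball.
move=> x /= xs; have [x0|x0] := leP (radial x) 0%R; first by right.
by left; rewrite /= habs (lt_le_trans as_)// h_noninc.
Qed.

End profile.

Lemma measurable_rearr_radial f :
  measurable_fun setT (rearr mu setT f \o radial : Rn R n -> \bar R).
Proof.
apply: measurable_radial_comp => s t _; exact: rearr_nonincreasing.
Qed.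

Lemma rearr_rearr_radial f t : measurable_fun setT f -> (0 < t)%R ->
  rearr mu setT (rearr mu setT f \o radial) t = rearr mu setT f t.
Proof.
move=> mf t0; apply: rearr_radial => //.
- by move=> s _; exact: rearr_ge0.
- by move=> s u _; exact: rearr_nonincreasing.
- by move=> l u l0 u0; exact: rearr_right_lsc.
Qed.

Lemma measurable_rearr_avg_radial f : measurable_fun setT f ->
  measurable_fun setT (rearr_avg mu setT f \o radial : Rn R n -> \bar R).
Proof.
by move=> mf; apply: measurable_radial_comp => s t; exact: rearr_avg_nonincreasing.
Qed.

Lemma rearr_avg0 f : rearr_avg mu setT f 0 = 0.
Proof. by rewrite /rearr_avg invr0 mul0e. Qed.

Lemma rearr_rearr_avg_radial f t : measurable_fun setT f -> (0 < t)%R ->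
  rearr mu setT (rearr_avg mu setT f \o radial) t = rearr_avg mu setT f t.
Proof.
move=> mf t0; apply: rearr_radial => //.
- move=> s; rewrite le_eqVlt => /predU1P[<-|]; last exact: rearr_avg_ge0.
  by rewrite rearr_avg0.
- by move=> s u; exact: rearr_avg_nonincreasing.
- by move=> l u l0 u0; exact: rearr_avg_right_lsc.
Qed.

(** The pointwise lower estimate: among the cubes containing [x] there is the
    smallest centred one, which collects the largest values of the radial
    function, so the average over it is the average of its rearrangement. *)
Lemma rearr_avg_le_HL_max f x : measurable_fun setT f ->
  rearr_avg mu setT f (radial x) <= HL_max (rearr mu setT f \o radial) x.
Proof.
move=> mf; set g := _ \o radial; set s := radial x.
have [s0|s0] := leP s 0%R.
  have -> : s = 0%R by apply/le_anti; rewrite s0 radial_ge0.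
  by rewrite rearr_avg0 HL_max_ge0.
have [l [l0 ls ballE]] := radial_ballE (ltW s0).
have lgt0 : (0 < l)%R.
  rewrite lt_neqAle l0 andbT eq_sym; apply/eqP => l00.
  by move: s0; rewrite -ls l00 expr0n gtn_eqF ?ltxx.
have xQ : centered_cube l x by rewrite -ballE /=.
apply: le_trans (@le_HL_max _ _ g (const_mx (- (l / 2))%R, l) x lgt0 xQ).
rewrite /cube_avg/= -/(centered_cube l) ls.
have mg : measurable_fun setT g by exact: measurable_rearr_radial.
have gs t : (0 < t)%R -> rearr mu setT g t = rearr mu setT f t.
  exact: rearr_rearr_radial.
rewrite -(eq_rearr_avg (mu := mu) s gs) muleC lee_pdivlMr// muleC.
apply: rearr_avg_le_integral => //.
- exact: measurable_cube.
- by rewrite -ls; exact: lebesgue_cube.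
- move=> y; rewrite -ballE/= => ys.
  by rewrite gee0_abs ?rearr_ge0// gs// rearr_nonincreasing.
- move=> y yQ; rewrite gee0_abs ?rearr_ge0// gs//; apply: rearr_nonincreasing.
  by rewrite leNgt; apply/negP => /ltW ys; apply: yQ; rewrite -ballE.
Qed.

End radial.

(** * The optimal domain space *)
Section optimal_domain.
Context (R : realType) (n : nat).
Hypothesis n_gt0 : (0 < n)%N.
Local Notation mu := (@lebesgue_Rn R n).
Local Notation leb := (@completed_lebesgue_measure R).
Local Notation rearr := (rearr mu setT).
Local Notation rearr_avg := (rearr_avg mu setT).
Variables (rY : (Rn R n -> \bar R) -> \bar R) (rY0 : (R -> \bar R) -> \bar R).
Hypothesis rY_norm : ri_norm mu setT rY.
Hypothesis rY0_rep : is_representation rY rY0.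
Implicit Types f g : Rn R n -> \bar R.

Let rY0_norm : ri_norm leb (Rpos R) rY0 := rY0_rep.1.

Let mfun_abse d (T : measurableType d) (D : set T) (f : T -> \bar R) :
  measurable_fun D f -> mfun_ge0 D (abse \o f).
Proof. by move=> mf; split=> [|x _]; [exact: measurableT_comp|exact: abse_ge0]. Qed.

Let mfun_rearr_avg f : measurable_fun setT f -> mfun_ge0 (Rpos R) (rearr_avg f).
Proof.
move=> mf; split; first exact: measurable_rearr_avg.
by move=> t; exact: rearr_avg_ge0.
Qed.

Let mfun_rearr f : mfun_ge0 (Rpos R) (rearr f).
Proof.
split; last by move=> t _; exact: rearr_ge0.
by rewrite measurable_RposE; exact: measurable_rearr.
Qed.

Let le_rY0 (u v : R -> \bar R) : mfun_ge0 (Rpos R) u -> mfun_ge0 (Rpos R) v ->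
  (forall t, (0 < t)%R -> u t <= v t) -> rY0 u <= rY0 v.
Proof.
by move=> mu_ mv uv; apply: (le_ri_norm rY0_norm) => //; apply: aeW => t; exact: uv.
Qed.

Let eq_rY0 (u v : R -> \bar R) : mfun_ge0 (Rpos R) u -> mfun_ge0 (Rpos R) v ->
  (forall t, (0 < t)%R -> u t = v t) -> rY0 u = rY0 v.
Proof.
by move=> mu_ mv uv; apply/le_anti/andP; split; apply: le_rY0 => // t t0;
  rewrite uv.
Qed.

Let finite_measureE (E : set (Rn R n)) : mu E < +oo ->
  exists2 m, (0 <= m)%R & mu E = m%:E.
Proof.
move=> Ey; have E0 : 0 <= mu E by exact: measure_ge0.
exists (fine (mu E)); first exact: fine_ge0.
by rewrite fineK// ge0_fin_numE.
Qed.

(** The hypothesis on [psi] enters through the norm of indicators, for which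
    [rearr_avg] is at most a multiple of [psi]; local integrability is inherited
    from the half-line, because [rearr_avg f] is at least its value at [m] on
    the interval (0, m). *)
Lemma rearr_avg_ri_norm : ri_space (Rpos R) rY0 (@psi R) ->
  ri_norm mu setT (rY0 \o rearr_avg).
Proof.
move=> [_ psiY]; have [mpsi psi0] := @mfun_psi R; split => /=.
- by move=> f [mf _]; apply: (ri_norm_ge0 rY0_norm); exact: mfun_rearr_avg.
- move=> f [mf f0]; have mf' := mfun_rearr_avg mf.
  rewrite (ri_norm_eq0 rY0_norm mf'); split.
    by move=> /ae_Rpos_exists[t t0]; exact: rearr_avg_eq0.
  by move=> fae; apply: aeW => t t0; exact: rearr_avg_ae0.
- move=> a f a0 [mf _]; rewrite -(ri_normZ rY0_norm a0 (mfun_rearr_avg mf)).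
  have maf : measurable_fun setT (fun x => a%:E * f x) by exact: measurable_funeM.
  apply: eq_rY0; first exact: mfun_rearr_avg.
    split; first by apply: measurable_funeM; exact: measurable_rearr_avg.
    by move=> t t0; rewrite mule_ge0 ?lee_fin// rearr_avg_ge0.
  by move=> t; exact: rearr_avgZ.
- move=> f g [mf _] [mg _].
  have mf' := mfun_rearr_avg mf; have mg' := mfun_rearr_avg mg.
  apply: le_trans (ri_normD rY0_norm mf' mg').
  apply: le_rY0; first by apply: mfun_rearr_avg; exact: emeasurable_funD.
    split; first by apply: emeasurable_funD; [case: mf'|case: mg'].
    by move=> t t0; rewrite adde_ge0// rearr_avg_ge0.
  by move=> t; exact: rearr_avgD.
- move=> f g [mf f0] [mg g0] fg; apply: le_rY0; try exact: mfun_rearr_avg.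
  move=> t; apply: le_rearr_avg_ae => //.
  by apply: filterS fg => x fg _; rewrite !gee0_abs ?f0 ?g0// fg.
- move=> f_ f mf_ [mf f0] ff.
  have mf_' j : measurable_fun setT (f_ j) by have [] := mf_ j.
  apply: (ri_norm_cvg rY0_norm); [move=> j; exact: mfun_rearr_avg|exact: mfun_rearr_avg|].
  have ff' : {ae mu, forall x, setT x ->
      nondecreasing_seq (fun j => `|f_ j x|) /\ `|f_ j x| @[j --> \oo] --> `|f x|}.
    apply: filterS ff => x ffx xT; have [nd cv] := ffx xT.
    have absE : (fun j => `|f_ j x|) = f_ ^~ x.
      by apply/funext => j; rewrite gee0_abs//; apply: (mf_ j).2.
    by rewrite absE gee0_abs// f0.
  apply: aeW => t t0; split.
    exact: (nondecreasing_rearr_avg mf_' ff').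
  exact: (cvg_rearr_avg mf_' mf ff').
- move=> E mE _ /finite_measureE[m _ Em].
  pose c := Num.max 1%R m.
  have c0 : (0 <= c)%R by rewrite le_max ler01.
  apply: (@le_lt_trans _ _ (c%:E * rY0 (@psi R))).
    rewrite -(ri_normZ rY0_norm c0 mfun_psi); apply: le_rY0.
    - by apply: mfun_rearr_avg; apply/measurable_EFinP; exact: measurable_indic.
    - split; first by apply: measurable_funeM; exact: mpsi.
      by move=> t t0; rewrite mule_ge0 ?lee_fin//; apply: psi0.
    - by move=> t; exact: rearr_avg_indic_le.
  rewrite lte_mul_pinfty ?lee_fin//.
  suff -> : rY0 (@psi R) = space_norm rY0 (@psi R) by [].
  apply: eq_rY0 => //; first exact: mfun_abse.
  by move=> t t0; apply/esym/gee0_abs; exact: psi0.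
- move=> E mE _ /finite_measureE[v v0 Ev].
  have [m m0 Em] : exists2 m : R, (0 < m)%R & mu E <= m%:E.
    by exists (v + 1)%R; [lra|rewrite Ev lee_fin; lra].
  have m0y : leb [set` `]0%R, m[] < +oo by rewrite completed_lebesgue_itv0 ?ltry// ltW.
  have sub0m : [set` `]0%R, m[] `<=` Rpos R.
    by rewrite measurable_RposE; apply: subset_itvl.
  have [C C0 HC] := ri_norm_local rY0_norm (measurable_completed_itv _) sub0m m0y.
  exists C => // f [mf f0]; apply: le_trans (HC _ (mfun_rearr_avg mf)).
  apply: (@le_trans _ _ (m%:E * rearr_avg f m)).
    have -> : \int[mu]_(x in E) f x = \int[mu]_(x in E) `|f x|.
      by apply: eq_integral => x _; rewrite gee0_abs// f0.
    exact: integral_le_rearr_avg.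
  rewrite muleC.
  have -> : rearr_avg f m * m%:E = \int[leb]_(t in `]0%R, m[) cst (rearr_avg f m) t.
    rewrite -(completed_lebesgue_itv0 (ltW m0)).
    by apply/esym/integral_cst; exact: measurable_completed_itv.
  apply: ge0_le_integral.
  - exact: measurable_completed_itv.
  - by move=> t _; exact: rearr_avg_ge0.
  - exact: measurable_cst.
  - apply: (measurable_funS (@measurable_Rpos R) sub0m).
    exact: measurable_rearr_avg.
  - move=> t; rewrite /= in_itv/= => /andP[t0 tm].
    by apply: rearr_avg_nonincreasing => //; exact: ltW.
- move=> f g [mf _] [mg _] fg.
  have -> : rearr_avg f = rearr_avg g by apply/funext => t; exact: eq_rearr_avg.
  by [].
Qed.

Lemma HL_max_bounded_op :
  bounded_op setT (rY0 \o rearr_avg) rY (@HL_max R n).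
Proof.
exists (3 ^+ n)%R; first by rewrite exprn_gt0.
move=> f [mf fX]; have mM := measurable_HL_max mf.
have Mle : space_norm rY (HL_max f) <= (3 ^+ n)%:E * space_norm (rY0 \o rearr_avg) f.
  rewrite rY0_rep.2// /space_norm abse_rearr /= rearr_avg_abse.
  have n30 : (0 <= 3 ^+ n :> R)%R by rewrite exprn_ge0.
  rewrite -(ri_normZ rY0_norm n30 (mfun_rearr_avg mf)); apply: le_rY0.
  - exact: mfun_rearr.
  - split; first by apply: measurable_funeM; exact: measurable_rearr_avg.
    by move=> t t0; rewrite mule_ge0 ?lee_fin// rearr_avg_ge0.
  - by move=> t; exact: rearr_HL_max_le.
split => //; split => //; apply: (le_lt_trans Mle).
by rewrite lte_mul_pinfty ?lee_fin ?exprn_ge0.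
Qed.

(** For every [f] in the domain space, the radial function [g] with the same
    rearrangement has the same norm there, while the maximal function of [g]
    dominates a function whose rearrangement is the average of that of [f]. This
    single inequality gives optimality and, for the indicator of a unit cube, the
    converse. *)
Lemma rearr_avg_bounded (rZ : (Rn R n -> \bar R) -> \bar R) :
  ri_norm mu setT rZ -> bounded_op setT rZ rY (@HL_max R n) ->
  exists2 C : R, (0 < C)%R & forall f, ri_space setT rZ f ->
    rY0 (rearr_avg f) <= C%:E * space_norm rZ f.
Proof.
move=> rZ_norm [C C0 HC]; exists C => // f [mf fZ].
pose g := rearr f \o @radial R n.
have mg : measurable_fun setT g by exact: measurable_rearr_radial.
have gf : space_norm rZ g = space_norm rZ f.
  apply: (ri_norm_rearr rZ_norm); try exact: mfun_abse.
  by move=> t t0; rewrite !rearr_abse; exact: rearr_rearr_radial.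
have [|[mMg MgY] Mg] := HC g; first by split => //; rewrite gf.
rewrite -gf; apply: le_trans Mg.
pose F := rearr_avg f \o @radial R n.
have mF : measurable_fun setT F by exact: measurable_rearr_avg_radial.
apply: (@le_trans _ _ (space_norm rY F)).
  rewrite rY0_rep.2// /space_norm abse_rearr; apply: le_rY0.
  - exact: mfun_rearr_avg.
  - exact: mfun_rearr.
  - by move=> t t0; rewrite rearr_rearr_avg_radial.
apply: (le_ri_norm rY_norm); try exact: mfun_abse.
apply: aeW => x _ /=; rewrite [leRHS]gee0_abs ?HL_max_ge0//.
have -> : `|F x| = F x by rewrite /F -[in RHS](abse_rearr_avg mu f).
exact: rearr_avg_le_HL_max.
Qed.

End optimal_domain.

Unset Implicit Arguments.

Theorem theorem3p2 (R : realType) (n : nat) (n_gt0 : (0 < n)%N)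
    (rY : (Rn R n -> \bar R) -> \bar R)
    (rY_norm : ri_norm (@lebesgue_Rn R n) [set: Rn R n] rY)
    (rY0 : (R -> \bar R) -> \bar R)
    (rY0_rep : is_representation rY rY0) :
  (ri_space (Rpos R) rY0 (@psi R) ->
     let rho := fun f : Rn R n -> \bar R =>
       space_norm rY0 (rearr_avg (@lebesgue_Rn R n) [set: Rn R n] f) in
     [/\ ri_norm (@lebesgue_Rn R n) [set: Rn R n] rho,
         bounded_op [set: Rn R n] rho rY (@HL_max R n) &
         forall rZ : (Rn R n -> \bar R) -> \bar R,
           ri_norm (@lebesgue_Rn R n) [set: Rn R n] rZ ->
           bounded_op [set: Rn R n] rZ rY (@HL_max R n) -> embeds [set: Rn R n] rZ rho]) /\
  (~ ri_space (Rpos R) rY0 (@psi R) ->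
     ~ exists rX : (Rn R n -> \bar R) -> \bar R,
         ri_norm (@lebesgue_Rn R n) [set: Rn R n] rX /\
         bounded_op [set: Rn R n] rX rY (@HL_max R n)).
Proof.
have rhoE : (fun f : Rn R n -> \bar R =>
    space_norm rY0 (rearr_avg (@lebesgue_Rn R n) [set: Rn R n] f)) =
  rY0 \o rearr_avg (@lebesgue_Rn R n) [set: Rn R n].
  by apply/funext => f; rewrite /space_norm abse_rearr_avg.
split=> [psiY rho|psiNY [rX [rX_norm rX_bounded]]].
  rewrite /rho rhoE; split.
  - exact: (rearr_avg_ri_norm rY0_rep psiY).
  - exact: (HL_max_bounded_op rY0_rep).
  move=> rZ rZ_norm rZ_bounded.
  have [C C0 HC] := rearr_avg_bounded n_gt0 rY_norm rY0_rep rZ_norm rZ_bounded.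
  exists C => // f fZ; have fC := HC f fZ; have [mf fZy] := fZ.
  have frho : space_norm (rY0 \o rearr_avg (@lebesgue_Rn R n) setT) f <=
      C%:E * space_norm rZ f by rewrite /space_norm /= rearr_avg_abse.
  split => //; split => //; apply: (le_lt_trans frho).
  by rewrite lte_mul_pinfty ?lee_fin// ltW.
apply: psiNY.
have [C C0 HC] := rearr_avg_bounded n_gt0 rY_norm rY0_rep rX_norm rX_bounded.
(* The averages of the rearrangement of the indicator of [Q] dominate [psi]. *)
pose Q : set (Rn R n) := cube 0%R 1%R.
have mQ : measurable Q by exact: measurable_cube.
have Q1 : lebesgue_Rn Q = 1 by rewrite lebesgue_cube// expr1n.
pose f x : \bar R := (\1_Q x)%:E.
have mf : measurable_fun setT f by apply/measurable_EFinP; exact: measurable_indic.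
have fX : ri_space setT rX f.
  split => //; rewrite /space_norm (_ : abse \o f = f); last first.
    by apply/funext => x; apply: gee0_abs; rewrite lee_fin.
  by apply: (ri_norm_indic rX_norm) => //; apply: (@le_lt_trans _ _ 1);
    rewrite ?ltry// -Q1.
have psi_le t : (0 < t)%R -> psi t <= rearr_avg (@lebesgue_Rn R n) setT f t.
  by move=> t0; exact: (psi_le_rearr_avg_indic mQ Q1).
have [mpsi psi0] := @mfun_psi R.
split => //; apply: (@le_lt_trans _ _ (C%:E * space_norm rX f)).
  apply: le_trans (HC f fX); apply: (le_ri_norm rY0_rep.1).
  - by split; [exact: measurableT_comp|move=> t _; exact: abse_ge0].
  - by split; [exact: measurable_rearr_avg|move=> t; exact: rearr_avg_ge0].
  - by apply: aeW => t t0; rewrite [leLHS](gee0_abs (psi0 t t0)) psi_le.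
by rewrite lte_mul_pinfty ?lee_fin ?ltW//; case: fX.
Qed.
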